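(* Assume that $B : L^2(\Omega)\to L^2(\Omega)$ is Lipschitz continuous, i.e. there is $L_B$ with $\|B(v^1)-B(v^2)\|\le L_B\|v^1-v^2\|$ for all $v^1,v^2\in L^2(\Omega)$. Let $\Theta^u,\Theta^\ell : C\to[0,r]$ satisfy $0\le\Theta^\ell(\varphi)\le\Theta^u(\varphi)\le r$ for all $\varphi\in C$, let $\eta : C\to[0,r]$ be the delay function, and assume: 1) $\Theta^u$ and $\Theta^\ell$ are continuous; 2) there is a constant $L$ such that $Z=\{\varphi\in C:\Theta^\ell(\varphi)=0\}$ is contained in $C\mathcal{L}_L=\left\{\varphi\in C:\ \sup_{t\ne s}\frac{\|\varphi(t)-\varphi(s)\|}{|t-s|}\le L\right\}$ (supremum over $t,s\in[-r,0]$); 3) $\eta$ is continuous and satisfies: for all $\varphi,\psi\in C$, if $\psi(\theta)=\varphi(\theta)$ for all $\theta\in[-\Theta^u(\varphi),-\Theta^\ell(\varphi)]$, then $\eta(\psi)=\eta(\varphi)$; 4) $\eta(\varphi)>0$ for all $\varphi\in Z$; 5) there exist $\omega>0$ and $L_\eta>0$ such that $|\eta(\varphi)-\eta(\psi)|\le L_\eta\|\varphi-\psi\|_C$ for all $\varphi,\psi\in U_\omega(Z)=\{\chi\in C:\ \exists\,\nu\in Z,\ \|\chi-\nu\|_C\le\omega\}$. Then for every initial function $\varphi\in C$ the initial value problem $$\frac{\partial}{\partial t}u(t,x)+Au(t,x)+d\,u(t,x)=\big(B(u(t-\eta(u_t)))\big)(x),\quad x\in\Omega,\ t>0,\qquad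 u|_{[-r,0]}=\varphi,$$ has a unique global mild solution $u\in C([-r,+\infty);L^2(\Omega))$. Moreover, if $S_t : C\to C$, $t\ge0$, is defined by $S_t\varphi=u_t$, where $u$ is the unique mild solution with initial function $\varphi$, then $(S_t,C)$ is a dynamical system, i.e. $S_0=\mathrm{Id}$; $S_tS_\tau=S_{t+\tau}$ for all $t,\tau\ge0$; for every $\varphi\in C$ the map $t\mapsto S_t\varphi\in C$ is continuous on $[0,\infty)$; and for every $t\ge0$, $\|\varphi^n-\varphi\|_C\to0$ implies $\|S_t\varphi^n-S_t\varphi\|_C\to0$ as $n\to\infty$.
   Context: Setting: $\Omega\subset\mathbb{R}^{n_0}$ is a smooth bounded domain; $r>0$ and $d\ge0$ are constants; $A$ is a densely defined self-adjoint positive linear operator with domain $D(A)\subset L^2(\Omega)$ and compact resolvent, so that $-A$ generates the analytic semigroup $e^{-At}$ on $L^2(\Omega)$. Notation: $C= C([-r,0];L^2(\Omega))$ with the sup-norm $\|\cdot\|_C$; $\|\cdot\|$ is the norm of $L^2(\Omega)$. For a function $u$ on an interval containing $[t-r,t]$, $u_t\in C$ is defined by $u_t(\theta)=u(t+\theta)$, $\theta\in[-r,0]$. The delay term is $F(\varphi)=B(\varphi(-\eta(\varphi)))$, $\varphi\in C$. Mild solution: $u\in C([-r,T];L^2(\Omega))$ is a mild solution on $[-r,T]$ of the initial value problem if $u|_{[-r,0]}=\varphi$ and $$u(t)=e^{-At}\varphi(0)+\int_0^t e^{-A(t-s)}\{F(u_s)-d\,u(s)\}\,ds,\quad t\in[0,T].$$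 A global mild solution is $u\in C([-r,+\infty);L^2(\Omega))$ whose restriction to $[-r,T]$ is a mild solution for every $T>0$. *)

(* Defs.v *)
From HB Require Import structures.
From mathcomp Require Import all_boot all_order all_algebra.
From mathcomp Require Import all_classical all_reals all_analysis.
From mathcomp Require Import measurable_realfun ess_sup_inf.

Set Implicit Arguments.
Unset Strict Implicit.
Unset Printing Implicit Defensive.
Import Order.TTheory GRing.Theory Num.Theory.
Import numFieldNormedType.Exports.

Local Open Scope classical_set_scope.
Local Open Scope ring_scope.

Lemma filterS4 T (F : set_system T) {FF : Filter F} (P Q S U V : set T) :
  (forall x, P x -> Q x -> S x -> U x -> V x) ->
  F P -> F Q -> F S -> F U -> F V.
Proof.
move=> PV FP FQ FS FU; apply: filterS3 (filterI FP FQ) FS FU => x [].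
exact: PV.
Qed.

Lemma filterS5 T (F : set_system T) {FF : Filter F} (P Q S U V W : set T) :
  (forall x, P x -> Q x -> S x -> U x -> V x -> W x) ->
  F P -> F Q -> F S -> F U -> F V -> F W.
Proof.
move=> PV FP FQ FS FU FV; apply: filterS4 (filterI FP FQ) FS FU FV => x [].
exact: PV.
Qed.

(* The library's [LspaceType mu p1] is a bare type of classes of functions modulo
   a.e. equality; the instances below make it a normed space, the operations
   being computed on representatives. *)
Section Lspace_normed.
Context d (T : measurableType d) (R : realType).
Variables (mu : {measure set T -> \bar R}) (p : \bar R) (p1 : (1 <= p)%E).
Local Notation L := (LspaceType mu p1).
Implicit Types f g h : L.

Lemma measurable_abs_poweR (h : T -> R) (r : R) : measurable_fun setT h ->
  measurable_fun setT ((fun x => poweR `|(h x)%:E|%E r) : T -> \bar R).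
Proof.
move=> mh; apply: (@measurableT_comp _ _ _ _ _ _ (fun x : \bar R => poweR x r)).
  exact: measurable_poweR.
apply: (@measurableT_comp _ _ _ _ _ _ (abse : \bar R -> \bar R)).
  exact: abse_measurable.
exact/measurable_EFinP.
Qed.

Lemma Lnorm_ae (f g : T -> R) : measurable_fun setT f -> measurable_fun setT g ->
  f = g %[ae mu] ->
  'N[mu]_p[EFin \o f]%E = 'N[mu]_p[EFin \o g]%E.
Proof.
move=> mf mg fg; rewrite !Lnorm.unlock; case: p p1 => [r _|_|//].
- congr (poweR _ r^-1); apply: ae_eq_integral => //.
  + exact: measurable_abs_poweR.
  + exact: measurable_abs_poweR.
  + by apply: filterS fg => x /(_ Logic.I)/= -> _.
- case: ifPn => // _; apply: eq_ess_sup.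
  by apply: filterS fg => x /(_ Logic.I)/= ->.
Qed.

Lemma LspaceP f g : (f : T -> R) = g %[ae mu] -> f = g.
Proof.
move=> fg.
have E : f = g :> {mfun_ mu, T >-> measurableTypeR R}.
  rewrite -(reprK (f : {mfun_ mu, T >-> measurableTypeR R})).
  rewrite -(reprK (g : {mfun_ mu, T >-> measurableTypeR R})).
  by apply/eqmodP/asboolP.
case: f g E {fg} => [f [[Hf]]] [g [[Hg]]] /= E; subst g.
by rewrite (Prop_irrelevance Hf Hg).
Qed.

Lemma measurable_Lspace f : measurable_fun setT (f : T -> R).
Proof.
exact: (@measurable_funPT _ _ _ _
  (repr (f : {mfun_ mu, T >-> measurableTypeR R}))).
Qed.

Lemma Lspace_Lfun f : (f : T -> R) \in Lfun mu p.
Proof.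
apply/andP; split; rewrite inE; first exact: measurable_Lspace.
exact: (@Lebesgue_finite _ _ _ _ _ p1 f).
Qed.

Section class.
Variables (f : T -> R) (fL : f \in Lfun mu p).
Let fmP : measurable_fun setT (f : T -> measurableTypeR R).
Proof. by move: fL => /andP[]; rewrite inE. Qed.

Let fm : {mfun T >-> measurableTypeR R} :=
  HB.pack (f : T -> measurableTypeR R)
    (@isMeasurableFun.Build _ _ T (measurableTypeR R) f fmP).
Let fq : {mfun_ mu, T >-> measurableTypeR R} := (\pi fm)%qT.

Let fqE : (fq : T -> R) = f %[ae mu].
Proof.
have : fq = (\pi fm)%qT by [].
move=> E.
have : repr fq = fm %[mod {mfun_ mu, T >-> measurableTypeR R}]%qT by rewrite reprK.
by move/eqmodP/asboolP.
Qed.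

Let fq_fin : finite_norm mu p fq.
Proof.
rewrite /finite_norm (Lnorm_ae _ _ fqE).
- by move: fL => /andP[_]; rewrite inE.
- exact: (@measurable_funPT _ _ _ _ (repr fq)).
- by move: fL => /andP[]; rewrite inE.
Qed.

HB.instance Definition _ := @isFinLebesgue.Build _ _ _ mu p p1 fq fq_fin.

Definition Lclass : L := fq.

Lemma LclassE : (Lclass : T -> R) = f %[ae mu].
Proof. exact: fqE. Qed.

End class.

HB.instance Definition _ := gen_eqMixin L.
HB.instance Definition _ := gen_choiceMixin L.

Lemma Lfun0 : (cst 0 : T -> R) \in Lfun mu p.
Proof. exact: (LfunP (0 : LfunType mu p1)). Qed.

Lemma LfunZ (a : R) (f : T -> R) : f \in Lfun mu p -> a *: f \in Lfun mu p.
Proof. by move=> fL; exact: (LfunP (a *: Lfun_Sub p1 fL)). Qed.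

Lemma LfunD (f g : T -> R) : f \in Lfun mu p -> g \in Lfun mu p ->
  f + g \in Lfun mu p.
Proof. by move=> fL gL; exact: (LfunP (Lfun_Sub p1 fL + Lfun_Sub p1 gL)). Qed.

Definition Lspace_zero : L := Lclass Lfun0.
Definition Lspace_scale (a : R) f : L := Lclass (LfunZ a (Lspace_Lfun f)).
Definition Lspace_opp f : L := Lspace_scale (-1) f.
Definition Lspace_add f g : L := Lclass (LfunD (Lspace_Lfun f) (Lspace_Lfun g)).

Let addA : associative Lspace_add.
Proof.
move=> f g h; apply: LspaceP.
have := LclassE (LfunD (Lspace_Lfun f) (Lspace_Lfun (Lspace_add g h))).
have := LclassE (LfunD (Lspace_Lfun g) (Lspace_Lfun h)).
have := LclassE (LfunD (Lspace_Lfun (Lspace_add f g)) (Lspace_Lfun h)).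
have := LclassE (LfunD (Lspace_Lfun f) (Lspace_Lfun g)).
apply: filterS4 => x /(_ Logic.I) e1 /(_ Logic.I) e2 /(_ Logic.I) e3.
move=> /(_ Logic.I) e4 _; rewrite e2 e4 !fctE e1 e3 !fctE.
exact: addrA.
Qed.

Let addC : commutative Lspace_add.
Proof.
move=> f g; apply: LspaceP.
have := LclassE (LfunD (Lspace_Lfun f) (Lspace_Lfun g)).
have := LclassE (LfunD (Lspace_Lfun g) (Lspace_Lfun f)).
apply: filterS2 => x /(_ Logic.I) e1 /(_ Logic.I) e2 _.
by rewrite e1 e2 !fctE; exact: addrC.
Qed.

Let add0 : left_id Lspace_zero Lspace_add.
Proof.
move=> f; apply: LspaceP.
have := LclassE (LfunD (Lspace_Lfun Lspace_zero) (Lspace_Lfun f)).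
have := LclassE Lfun0.
apply: filterS2 => x /(_ Logic.I) e1 /(_ Logic.I) e2 _.
by rewrite e2 !fctE e1; exact: add0r.
Qed.

Let addN : left_inverse Lspace_zero Lspace_opp Lspace_add.
Proof.
move=> f; apply: LspaceP.
have := LclassE (LfunD (Lspace_Lfun (Lspace_opp f)) (Lspace_Lfun f)).
have := LclassE (LfunZ (-1) (Lspace_Lfun f)).
have := LclassE Lfun0.
apply: filterS3 => x /(_ Logic.I) e1 /(_ Logic.I) e2 /(_ Logic.I) e3 _.
rewrite e1 e3 !fctE e2 !fctE.
by rewrite scaleN1r addNr.
Qed.

HB.instance Definition _ := GRing.isZmodule.Build L addA addC add0 addN.

Let scaleA (a b : R) f :
  Lspace_scale a (Lspace_scale b f) = Lspace_scale (a * b) f.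
Proof.
apply: LspaceP.
have := LclassE (LfunZ a (Lspace_Lfun (Lspace_scale b f))).
have := LclassE (LfunZ b (Lspace_Lfun f)).
have := LclassE (LfunZ (a * b) (Lspace_Lfun f)).
apply: filterS3 => x /(_ Logic.I) e1 /(_ Logic.I) e2 /(_ Logic.I) e3 _.
by rewrite e1 e3 !fctE e2 !fctE scalerA.
Qed.

Let scale1 : left_id 1 Lspace_scale.
Proof.
move=> f; apply: LspaceP.
have := LclassE (LfunZ 1 (Lspace_Lfun f)).
by apply: filterS => x /(_ Logic.I) e _; rewrite e !fctE scale1r.
Qed.

Let scaleDr : right_distributive Lspace_scale +%R.
Proof.
move=> a f g; apply: LspaceP.
have e1 := LclassE (LfunZ a (Lspace_Lfun (Lspace_add f g))).
have e2 := LclassE (LfunD (Lspace_Lfun f) (Lspace_Lfun g)).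
have e3 := LclassE
  (LfunD (Lspace_Lfun (Lspace_scale a f)) (Lspace_Lfun (Lspace_scale a g))).
have := LclassE (LfunZ a (Lspace_Lfun g)).
have := LclassE (LfunZ a (Lspace_Lfun f)).
move: e1 e2 e3; apply: filterS5 => x /(_ Logic.I) e1 /(_ Logic.I) e2.
move=> /(_ Logic.I) e3 /(_ Logic.I) e4 /(_ Logic.I) e5 _.
rewrite e1 e3 !fctE e2 e4 e5 !fctE; exact: scalerDr.
Qed.

Let scaleDl f : {morph Lspace_scale^~ f : a b / a + b}.
Proof.
move=> a b; apply: LspaceP.
have := LclassE (LfunZ (a + b) (Lspace_Lfun f)).
have := LclassE (LfunD (Lspace_Lfun (Lspace_scale a f)) (Lspace_Lfun (Lspace_scale b f))).
have := LclassE (LfunZ b (Lspace_Lfun f)).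
have := LclassE (LfunZ a (Lspace_Lfun f)).
apply: filterS4 => x /(_ Logic.I) e1 /(_ Logic.I) e2 /(_ Logic.I) e3.
move=> /(_ Logic.I) e4 _; rewrite e4 e3 !fctE e1 e2 !fctE; exact: scalerDl.
Qed.

HB.instance Definition _ := GRing.Zmodule_isLmodule.Build R L
  scaleA scale1 scaleDr scaleDl.

Definition Lspace_norm f : R := fine ('N[mu]_p[EFin \o (f : T -> R)])%E.

Let normE f : (Lspace_norm f)%:E = 'N[mu]_p[EFin \o (f : T -> R)]%E.
Proof. exact: (finite_norm_fine (Lfun_Sub p1 (Lspace_Lfun f))). Qed.

Lemma Lspace_addE f g : (f + g : T -> R) = (f : T -> R) + g %[ae mu].
Proof. exact: LclassE. Qed.

Lemma Lspace_scaleE a f : (a *: f : T -> R) = a *: (f : T -> R) %[ae mu].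
Proof. exact: LclassE. Qed.

Let normD f g : Lspace_norm (f + g) <= Lspace_norm f + Lspace_norm g.
Proof.
rewrite -lee_fin EFinD !normE (Lnorm_ae _ _ (Lspace_addE f g)).
- exact: (eminkowski mu (measurable_Lspace f) (measurable_Lspace g)).
- exact: measurable_Lspace.
- by apply: measurable_funD; exact: measurable_Lspace.
Qed.

Let normZ (a : R) f : Lspace_norm (a *: f) = `|a| * Lspace_norm f.
Proof.
apply: EFin_inj; rewrite EFinM !normE (Lnorm_ae _ _ (Lspace_scaleE a f)).
- exact: (LnormZ (Lfun_Sub p1 (Lspace_Lfun f)) a).
- exact: measurable_Lspace.
- by apply: measurable_funM => //; exact: measurable_Lspace.
Qed.

Let norm0_eq0 f : Lspace_norm f = 0 -> f = 0.
Proof.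
move=> f0; apply: LspaceP.
have := LclassE Lfun0.
have := fine_Lnormr_eq0 (f := Lfun_Sub p1 (Lspace_Lfun f)) f0.
apply: filterS2 => x /(_ Logic.I) e1 /(_ Logic.I) e2 _.
by rewrite [LHS]e1 e2.
Qed.

HB.instance Definition _ := Lmodule_isNormed.Build R L normD normZ norm0_eq0.

End Lspace_normed.
Section Lebesgue_tuple.
Context {R : realType}.
Local Notation Rn n := (n.-tuple (measurableTypeR R)).

Definition tuple_extend n (p : Rn n * measurableTypeR R) : Rn n.+1 :=
  [the n.+1.-tuple (measurableTypeR R) of p.2 :: p.1].

Lemma measurable_tuple_extend n : measurable_fun setT (@tuple_extend n).
Proof. exact: measurable_cons. Qed.

Section step.
Variables (n : nat) (mu : {measure set (Rn n) -> \bar R}).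

Definition lebesgue_step : set (Rn n.+1) -> \bar R :=
  pushforward (mu \x (@lebesgue_measure R))%E (@tuple_extend n).

Let step0 : lebesgue_step set0 = 0%E.
Proof. by rewrite /lebesgue_step /pushforward preimage_set0 measure0. Qed.

Let step_ge0 A : (0 <= lebesgue_step A)%E.
Proof. by rewrite /lebesgue_step /pushforward measure_ge0. Qed.

Let step_additive : semi_sigma_additive lebesgue_step.
Proof.
move=> F mF tF mUF; rewrite /lebesgue_step /pushforward preimage_bigcup.
apply: measure_semi_sigma_additive.
- by move=> k; rewrite -[X in measurable X]setTI; exact: measurable_tuple_extend.
- apply/trivIsetP => /= i j _ _ ij; rewrite -preimage_setI.
  by move/trivIsetP : tF => /(_ _ _ _ _ ij) ->//; rewrite preimage_set0.
- by rewrite -preimage_bigcup -[X in measurable X]setTI; exact: measurable_tuple_extend.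
Qed.

HB.instance Definition _ := isMeasure.Build _ _ _ lebesgue_step
  step0 step_ge0 step_additive.

End step.

Fixpoint lebesgue_tuple n : {measure set (Rn n) -> \bar R} :=
  match n with
  | 0 => \d_([tuple] : Rn 0)
  | m.+1 => lebesgue_step (lebesgue_tuple m)
  end.

(* The measure lives on tuples, which carry the product sigma-algebra, whereas
   domains are subsets of the normed space of row vectors. *)
Definition rV_of_tuple n (t : Rn n) : 'rV[R]_n := \row_i tnth t i.

Lemma measurable_rV_ball n (x : 'rV[R]_n) (e : R) :
  measurable (@rV_of_tuple n @^-1` ball x e).
Proof.
have [e0|e0] := leP e 0.
  rewrite (_ : _ @^-1` _ = set0) ?measurable0// -subset0 => t /=.
  by rewrite -ball_normE /= => /(le_lt_trans (normr_ge0 _)); rewrite ltNge e0.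
rewrite (_ : _ @^-1` _ =
    \bigcap_(i : 'I_n) [set t | ball (x ord0 i) e (tnth t i)]).
  apply: fin_bigcap_measurable => // i _.
  rewrite -[X in measurable X]setTI.
  apply: (@measurable_tnth _ (measurableTypeR R) n i measurableT).
  exact: measurable_ball.
apply/seteqP; split => t /=.
  by move=> [_ xt] i _; have := xt ord0 i; rewrite mxE.
move=> xt; split => // i j; rewrite mxE (ord1 i); exact: xt.
Qed.

Lemma measurable_rV_open n (U : set 'rV[R]_n) :
  open U -> measurable (@rV_of_tuple n @^-1` U).
Proof.
move=> oU.
pose c (q : 'rV[rat]_n * rat) : set 'rV[R]_n :=
  ball (map_mx (@ratr R) q.1 : 'rV[R]_n) (ratr q.2).
rewrite (_ : U = \bigcup_q (if `[< c q `<=` U >] then c q else set0)).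
  rewrite preimage_bigcup; apply: countable_bigcupT_measurable => // q.
  by case: ifPn => _; [exact: measurable_rV_ball|rewrite preimage_set0].
apply/seteqP; split => [x Ux|x [q _]]; last first.
  by case: ifPn => // /asboolP cU /cU.
have /nbhs_ballP[e /= e0 eU] : nbhs x U by exact: open_nbhs_nbhs.
have [s] := rat_in_itvoo (divr_gt0 e0 (ltr0n _ 2)).
rewrite in_itv/= => /andP[s0 se].
have /choice[q qx] : forall i, exists a : rat, `|x ord0 i - ratr a| < ratr s.
  move=> i; have : x ord0 i - ratr s < x ord0 i + ratr s by rewrite ltrD2l gtrN.
  move=> /rat_in_itvoo[a]; rewrite in_itv/= => /andP[a1 a2]; exists a.
  by rewrite ltr_distlC a1.
exists (\row_i q i, s) => //.
have cx : c (\row_i q i, s) x.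
  by split=> //= i j; rewrite !mxE (ord1 i) /ball/= distrC.
have cU : c (\row_i q i, s) `<=` U.
  move=> y cy; apply: eU; apply: (@le_ball _ _ _ (ratr s + ratr s)).
    by rewrite [leRHS]splitr lerD// ltW.
  by apply: ball_triangle cy; exact: ball_sym.
by rewrite (asboolT cU).
Qed.

End Lebesgue_tuple.

Section domain.
Context {R : realType}.

Fixpoint Ck (k m : nat) (f : 'rV[R]_m -> R) : Prop :=
  continuous f /\
  match k with
  | 0 => True
  | l.+1 => forall j : 'I_m,
      (forall x, derivable f x (delta_mx ord0 j)) /\
      Ck l (fun x => 'D_(delta_mx ord0 j) f x)
  end.

Definition smooth (m : nat) (f : 'rV[R]_m -> R) : Prop := forall k, Ck k f.

(* Near each boundary point, and up to relabelling and reversing the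
   coordinate axes, [Omega] is the region above the graph of a smooth
   function of the other n - 1 coordinates. *)
Definition smooth_boundary (n : nat) (Omega : set 'rV[R]_n) : Prop :=
  forall p, (closure Omega `\` Omega°) p ->
    exists (i : 'I_n) (b : bool) (g : 'rV[R]_n.-1 -> R), smooth g /\
      \forall x \near p, Omega x <-> 0 < (-1) ^+ b * (x ord0 i - g (col' i x)).

Structure smooth_bounded_domain (n : nat) := SmoothBoundedDomain {
  domain_set :> set 'rV[R]_n ;
  domain_neq0 : domain_set !=set0 ;
  domain_open : open domain_set ;
  domain_connected : connected domain_set ;
  domain_bounded : bounded_set domain_set ;
  domain_smooth : smooth_boundary domain_set
}.

Arguments domain_open {n} Omega : rename.

Variables (n : nat) (Omega : smooth_bounded_domain n).

Definition domain_measure : {measure set (n.-tuple (measurableTypeR R)) -> \bar R} :=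
  mrestr (lebesgue_tuple n) (measurable_rV_open (domain_open Omega)).

Definition L2 : Type := LspaceType2 domain_measure.

HB.instance Definition _ := NormedModule.copy L2 (LspaceType2 domain_measure).

Definition L2_inner (f g : L2) : R :=
  \int[domain_measure]_x
    ((f : LspaceType2 domain_measure) x * (g : LspaceType2 domain_measure) x).

End domain.
Arguments smooth_bounded_domain R n : clear implicits.

Section history.
Context {R : realType}.
Variables (H : normedModType R) (r : R).

(* Continuous functions on [-r,0] are encoded as functions on R that vanish
   outside [-r,0], so that equality is equality on [-r,0]. *)
Definition history_set : set (R -> H) :=
  [set f | {within `[- r, 0], continuous f} /\
           forall x, x \notin `[- r, 0] -> f x = 0].

Definition history_pred : {pred R -> H} := mem history_set.

Lemma history_submod_closed : submod_closed history_pred.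
Proof.
split=> [|a f g]; rewrite !inE.
  by split=> // x; exact: cvg_cst.
move=> [cf zf] [cg zg]; split=> [x|x xr].
  by apply: cvgD; [apply: cvgZr; exact: cf|exact: cg].
by rewrite !fctE zf// zg// scaler0 addr0.
Qed.

HB.instance Definition _ := GRing.isSubmodClosed.Build R (R -> H) history_pred
  history_submod_closed.

Definition history : Type := {f : R -> H | f \in history_pred}.

HB.instance Definition _ := SubType.on history.
HB.instance Definition _ := [Choice of history by <:].
HB.instance Definition _ := [SubChoice_isSubLmodule of history by <:].

Definition history_fun (phi : history) : R -> H := val phi.
Coercion history_fun : history >-> Funclass.

Implicit Types phi psi : history.

Definition history_norm phi : R := sup [set `|phi t| | t in `[- r, 0]].

Lemma historyP phi : history_set phi.
Proof. by have := valP phi; rewrite inE. Qed.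

Lemma history_has_ubound phi : has_ubound [set `|phi t| | t in `[- r, 0]].
Proof.
have /compact_bounded : compact (phi @` `[- r, 0]).
  apply: continuous_compact; last exact: segment_compact.
  by have [] := historyP phi.
move=> [M [Mreal Mb]]; exists (M + 1) => _ [t tr <-].
by apply: (Mb (M + 1)); [rewrite ltrDl|exists t].
Qed.

Lemma history_le_norm phi t : `|phi t| <= history_norm phi.
Proof.
have key s : s \in `[- r, 0] -> `|phi s| <= history_norm phi.
  by move=> sr; apply: ub_le_sup; [exact: history_has_ubound|exists s].
have [/key//|tr] := boolP (t \in `[- r, 0]).
have [_ /(_ _ tr)->] := historyP phi; rewrite normr0.
have [[s sr]|nr] := pselect (exists s, s \in `[- r, 0]).
  exact: le_trans (key s sr).
rewrite /history_norm (_ : [set _ | _ in _] = set0) ?sup0//.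
by rewrite -subset0 => y [s sr _]; apply: nr; exists s.
Qed.

Lemma history_norm_le phi M : 0 <= M ->
  (forall t, t \in `[- r, 0] -> `|phi t| <= M) -> history_norm phi <= M.
Proof.
move=> M0 phiM.
have [E0|/set0P E0] := eqVneq [set `|phi t| | t in `[- r, 0]] set0.
  by rewrite /history_norm E0 sup0.
by apply: ge_sup => // _ [t tr <-]; exact: phiM.
Qed.

Let norm_ge0 phi : 0 <= history_norm phi.
Proof. exact: le_trans (history_le_norm phi 0). Qed.

Let norm_add phi psi :
  history_norm (phi + psi) <= history_norm phi + history_norm psi.
Proof.
apply: history_norm_le => [|t _]; first exact: addr_ge0.
by apply: le_trans (ler_normD _ _) _; apply: lerD; exact: history_le_norm.
Qed.

Let norm_scale (a : R) phi : history_norm (a *: phi) = `|a| * history_norm phi.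
Proof.
have leZ (b : R) psi : history_norm (b *: psi) <= `|b| * history_norm psi.
  apply: history_norm_le => [|t _]; first exact: mulr_ge0.
  rewrite [X in `|X|](_ : _ = b *: psi t)//.
  by rewrite normrZ ler_wpM2l//; exact: history_le_norm.
have [->|a0] := eqVneq a 0.
  apply/eqP; rewrite eq_le leZ/= normr0 mul0r; exact: norm_ge0.
apply/eqP; rewrite eq_le leZ/= -ler_pdivlMl ?normr_gt0//.
by rewrite -normfV; apply: le_trans (leZ _ _); rewrite scalerA mulVf// scale1r.
Qed.

Let norm_eq0 phi : history_norm phi = 0 -> phi = 0.
Proof.
move=> phi0; apply/val_inj/funext => t /=; apply/eqP.
rewrite -normr_le0 -phi0; exact: (history_le_norm phi t).
Qed.

HB.instance Definition _ := Lmodule_isNormed.Build R history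
  norm_add norm_scale norm_eq0.

(* [history_at u t] is the segment s |-> u (t + s) of [u]; it is only
   meaningful when [u] is continuous on [t - r, t], and is 0 otherwise. *)
Definition history_at (u : R -> H) (t : R) : history :=
  insubd (0 : history) (fun s => if s \in `[- r, 0] then u (t + s) else 0).

Lemma history_atE (u : R -> H) (t s : R) :
  {within `[t - r, t], continuous u} -> s \in `[- r, 0] ->
  history_at u t s = u (t + s).
Proof.
move=> /subspace_continuousP cu sr; rewrite /history_at /history_fun.
have shift x : x \in `[- r, 0] -> t + x \in `[t - r, t].
  by rewrite !in_itv/= => /andP[rx x0]; rewrite lerD2l rx/= gerDl.
rewrite insubdK ?sr//; rewrite inE; split=> [|x /negbTE->//].
apply/subspace_continuousP => x xr; apply/cvgrPdist_lt => e e0.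
have xr' : x \in `[- r, 0] by [].
have /cvgrPdist_lt/(_ e e0) := cu _ (shift _ xr').
rewrite !near_withinE !near_nbhs => /nbhs_ballP[delta /= delta0 h].
apply/nbhs_ballP; exists delta => //= y xy yr.
have yr' : y \in `[- r, 0] by [].
rewrite /from_subspace xr' yr'; apply: h; last exact: shift.
by rewrite /ball/= opprD addrACA subrr add0r.
Qed.

End history.

Section operator.
Context {R : realType} (n : nat) (Omega : smooth_bounded_domain R n).
Local Notation H := (L2 Omega).

(* An unbounded operator is a domain [D] and a function [A], of which only the
   values on [D] matter. *)
Variables (D : set H) (A : H -> H).

Definition linear_operator : Prop :=
  D 0 /\ forall (a : R) x y, D x -> D y ->
    D (a *: x + y) /\ A (a *: x + y) = a *: A x + A y.

(* [z] is the value at [y] of the adjoint of [A] ([D] being dense). *)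
Definition adjoint_graph (y z : H) : Prop :=
  forall x, D x -> L2_inner (A x) y = L2_inner x z.

Definition self_adjoint : Prop :=
  forall y z, adjoint_graph y z <-> D y /\ z = A y.

Definition positive_operator : Prop := forall x, D x -> 0 <= L2_inner (A x) x.

End operator.

Section semigroup.
Context {R : realType} (H : normedModType R).

Definition compact_operator (K : H -> H) : Prop :=
  compact (closure (K @` [set x | `|x| <= 1])).

Definition has_compact_resolvent (D : set H) (A : H -> H) : Prop :=
  exists (lambda : R) (K : H -> H),
    [/\ forall y, D (K y) /\ A (K y) - lambda *: K y = y,
        forall x, D x -> K (A x - lambda *: x) = x &
        compact_operator K].

(* Strongly continuous semigroups of bounded linear operators; only the values
   [E t] with [0 <= t] matter. *)
Definition C0_semigroup (E : R -> H -> H) : Prop :=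
  [/\ forall t, 0 <= t ->
        continuous (E t) /\
        forall (a : R) x y, E t (a *: x + y) = a *: E t x + E t y,
      forall x, E 0 x = x,
      forall s t, 0 <= s -> 0 <= t -> forall x, E (s + t) x = E s (E t x) &
      forall x, E t x @[t --> 0^'+] --> x].

Definition generator (E : R -> H -> H) (D : set H) (G : H -> H) : Prop :=
  forall x y, (t^-1 *: (E t x - x) @[t --> 0^'+] --> y) <-> D x /\ y = G x.

(* Riemann integral of a vector-valued function on [a,b]: limit of the Riemann
   sums over the tagged partitions a = x 0 <= tag 0 <= x 1 <= ... <= x m = b. *)
Definition is_RInt (f : R -> H) (a b : R) (I : H) : Prop :=
  forall e : R, 0 < e -> exists2 delta : R, 0 < delta &
    forall (m : nat) (x tag : nat -> R), x 0%N = a -> x m = b ->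
      (forall i, (i < m)%N ->
        x i <= tag i <= x i.+1 /\ x i.+1 - x i < delta) ->
      `|\sum_(i < m) (x i.+1 - x i) *: f (tag i) - I| < e.

End semigroup.

Section mild.
Context {R : realType} (H : normedModType R).
Variables (r d : R) (E : R -> H -> H) (B : H -> H) (eta : history H r -> R).

Definition delay_term (phi : history H r) : H := B (phi (- eta phi)).

(* [E t] stands for e^{-At}. *)
Definition mild_solution (phi : history H r) (T : R) (u : R -> H) : Prop :=
  [/\ {within `[- r, T], continuous u},
      forall s, s \in `[- r, 0] -> u s = phi s &
      forall t, t \in `[0, T] -> exists2 I : H,
        is_RInt (fun s => E (t - s) (delay_term (history_at r u s) - d *: u s))
          0 t I &
        u t = E t (phi 0) + I].

Definition global_mild_solution (phi : history H r) (u : R -> H) : Prop :=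
  {within `[- r, +oo[, continuous u} /\
  forall T, 0 < T -> mild_solution phi T u.

End mild.

Definition dynamical_system {R : realType} (X : normedModType R)
    (S : R -> X -> X) : Prop :=
  [/\ forall x, S 0 x = x,
      forall t tau, 0 <= t -> 0 <= tau -> forall x, S t (S tau x) = S (t + tau) x,
      forall x, {within `[0, +oo[, continuous (fun t => S t x)} &
      forall t, 0 <= t -> forall (x_ : nat -> X) (x : X),
        `|x_ k - x| @[k --> \oo] --> (0 : R) ->
        `|S t (x_ k) - S t x| @[k --> \oo] --> (0 : R)].

Definition lipschitz_history {R : realType} (H : normedModType R) (r L : R)
    (phi : history H r) : Prop :=
  forall t s, t \in `[- r, 0] -> s \in `[- r, 0] -> t != s ->
    `|phi t - phi s| / `|t - s| <= L.

(* Main.v *)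
(* By the uniform boundedness principle, |E t| <= M locally uniformly in t >= 0.

   The delay term F is not Lipschitz, but for two curves u, v close to an initial
   history phi and for small times s,
     |F(u_s) - F(v_s)| <= e + K sup_[-r,s] |u - v|,
   where e is arbitrarily small with |v_0 - phi| (and 0 if v_0 = phi), for u_0 = phi.
   If Theta_l(phi) > 0, the ignoring condition makes the delay a function of the
   initial history alone, and u is uniformly continuous. If Theta_l(phi) = 0, the
   delay is bounded below, so that both delayed values are read on the initial
   histories; phi is Lipschitz there and eta is Lipschitz around phi.

   This estimate yields local solutions by Picard iteration, and local continuous
   dependence. Solutions grow at most exponentially since B is Lipschitz; with
   |u(t) - E(t-s) u(s)| <= C (t-s), a real induction on the length of the time interval
   globalizes both facts, uniqueness being continuous dependence for equal data. *)

Require Import Defs.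
From HB Require Import structures.
From mathcomp Require Import all_boot all_order all_algebra.
From mathcomp Require Import all_classical all_reals all_analysis.
From mathcomp Require Import measurable_realfun ring lra.

Set Implicit Arguments.
Unset Strict Implicit.
Unset Printing Implicit Defensive.
Import Order.TTheory GRing.Theory Num.Theory.
Import numFieldNormedType.Exports.

Local Open Scope classical_set_scope.
Local Open Scope ring_scope.

(** * Preliminaries on real intervals and normed spaces *)

(** The obstacle is the term e of the local estimate: when the delay changes, u is evaluated at two
    nearby times, which costs a modulus of continuity of u and not a multiple of |u - v|. So u is
    fixed before e is chosen, and the admissible distance of the initial histories depends on u. For
    equal initial histories e drops out, and the Lipschitz bound that remains makes the Picard map a
    contraction; for different ones only continuity in the data, without a rate, survives.
    Gronwall's inequality is replaced by absorption: on an interval so short that M D T <= 1/2, the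
    maximum N of the norm under study satisfies N <= c + N/2. In the real inductions the passage to
    a limit time needs a uniformity that the earlier times do not supply. It comes from comparing
    every solution with a semigroup orbit over a last short interval, where the forcing term is
    bounded a priori. Limits of Riemann sums and of Picard iterates, the uniform boundedness
    principle and left limits of solutions all rest on completeness of L^2, obtained by the
    Riesz-Fischer argument on representatives. *)

Lemma ler_norm_dist_triangle (R : numDomainType) (V : normedZmodType R) (z x y : V) :
  `|x - y| <= `|x - z| + `|z - y|.
Proof. by rewrite (le_trans _ (ler_normD _ _))// subrKA. Qed.

Lemma continuous_distP (R : realType) (V W : normedModType R) (f : V -> W) :
  continuous f <->
  forall x e, 0 < e -> exists2 k : R, 0 < k & forall y, `|y - x| < k -> `|f y - f x| < e.
Proof.
split=> [cf x e e0|cf x].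
  have /cvgrPdist_lt/(_ _ e0)/nbhs_normP[k /= k0 h] := cf x.
  by exists k => // y yx; rewrite distrC; apply: h; rewrite /= distrC.
apply/cvgrPdist_lt => e e0; have [k k0 h] := cf x e e0.
by apply/nbhs_normP; exists k => // y /= yx; rewrite distrC; apply: h; rewrite distrC.
Qed.

(** The point [y] may leave the curve, in a space that need not be locally compact; one [k] still
    serves all [s] because [[a, b]] is compact. Applied to [eta] along the curve of histories of
    [u]. *)
Lemma continuous_near_compact (R : realType) (V W : normedModType R)
    (u : R -> V) (g : V -> W) (a b e : R) : continuous u -> continuous g -> 0 < e ->
  exists2 k : R, 0 < k & forall s, a <= s <= b ->
    forall y, `|y - u s| <= k -> `|g y - g (u s)| <= e.
Proof.
move=> cu cg e0.
have /compact_near_coveringP/(_ R (0^'+) (fun k s => forall y, `|y - u s| <= k ->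
    `|g y - g (u s)| <= e) _) := @segment_compact R a b.
case=> [s0 _|k /= k0 hk].
  have [|rho rho0 hrho] := (continuous_distP g).1 cg (u s0) (e / 2); first exact: divr_gt0.
  have [|del del0 hdel] := (continuous_distP u).1 cu s0 (rho / 2); first exact: divr_gt0.
  exists (ball s0 del, [set k | k < rho / 2]).
    split=> /=; first exact: nbhsx_ballx.
    by apply: nbhs_right_lt; exact: divr_gt0.
  move=> [s k] /= [+ krho] y yus.
  rewrite -ball_normE/= distrC => /hdel us.
  apply: le_trans (ler_norm_dist_triangle (g (u s0)) _ _) _; rewrite [leRHS]splitr.
  apply: lerD; last first.
    by rewrite distrC ltW// hrho// (lt_trans us)// ltr_pdivrMr// ltr_pMr// ltr1n.
  rewrite ltW// hrho//; apply: le_lt_trans (ler_norm_dist_triangle (u s) _ _) _.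
  by rewrite [ltRHS]splitr ler_ltD// (le_trans yus)// ltW.
have k20 : 0 < k / 2 by rewrite divr_gt0.
exists (k / 2) => // s sab y ys; apply: (hk (k / 2) _ _ s) => //=.
by rewrite sub0r normrN gtr0_norm// ltr_pdivrMr// ltr_pMr// ltr1n.
Qed.

Lemma uniform_continuous_segment (R : realType) (W : normedModType R)
    (f : R -> W) (a b e : R) : continuous f -> 0 < e ->
  exists2 k : R, 0 < k & forall s, a <= s <= b -> forall t, `|t - s| <= k -> `|f t - f s| <= e.
Proof. by move=> cf e0; apply: (@continuous_near_compact R R W idfun) => // x; exact: cvg_id. Qed.

(** The set of times up to which [P] holds contains its supremum by the left-limit hypothesis, and
    would go past it by the right-extension hypothesis if it were below [T]. *)
Lemma real_induction (R : realType) (P : R -> Prop) (T : R) : 0 <= T -> P 0 ->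
  (forall t, 0 <= t -> t < T -> P t -> exists2 k, 0 < k &
    forall s, t <= s <= t + k -> s <= T -> P s) ->
  (forall t, 0 < t -> t <= T -> (forall s, 0 <= s < t -> P s) -> P t) ->
  P T.
Proof.
move=> T0 P0 Pr Pl.
pose A := [set t | 0 <= t <= T /\ forall s, 0 <= s <= t -> P s].
have A0 : A 0.
  split; first by rewrite lexx.
  by move=> s s0; have -> : s = 0 by apply/eqP; rewrite eq_le andbC.
have supA : has_sup A by split; [exists 0|exists T => t [/andP[]]].
have s0 : 0 <= sup A by apply: ub_le_sup => //; case: supA.
have sT : sup A <= T by apply: ge_sup; [exists 0|move=> t [/andP[]]].
have below s : 0 <= s < sup A -> P s.
  move=> /andP[s_ge0 sA].
  have [|t [tT Pt]] := sup_adherent (eps := sup A - s) _ supA; first by rewrite subr_gt0.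
  by rewrite subKr => st; apply: Pt; rewrite s_ge0 ltW.
have AsupA : A (sup A).
  split; first by rewrite s0.
  move=> s /andP[s_ge0]; rewrite le_eqVlt => /predU1P[->|sA]; last by apply: below; rewrite s_ge0.
  have [-> //|sup0] := eqVneq (sup A) 0.
  by apply: Pl => //; rewrite lt_neqAle eq_sym sup0.
suff <- : sup A = T by case: AsupA => _; apply; rewrite s0 lexx.
apply/eqP; rewrite eq_le sT leNgt/=; apply/negP => ltT.
have PsA : P (sup A) by apply: AsupA.2; rewrite s0 lexx.
have [k k0 hk] := Pr _ s0 ltT PsA.
pose t := Num.min (sup A + k) T.
have At : A t.
  split; first by rewrite /t le_min ge_min lexx orbT T0 addr_ge0// ltW.
  move=> s /andP[s_ge0]; rewrite le_min => /andP[sk sT'].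
  have [sA|As] := ltP s (sup A); first by apply: below; rewrite s_ge0.
  by apply: hk => //; rewrite As.
have : t <= sup A by apply: ub_le_sup => //; case: supA.
by rewrite leNgt lt_min ltT ltrDl k0.
Qed.

Lemma ler_dist_min (R : realDomainType) (c s t : R) :
  `|Num.min s c - Num.min t c| <= `|s - t|.
Proof.
have h1 := ler_norm (s - t); have := ler_norm (t - s); rewrite [`|t - s|]distrC => h2.
rewrite ler_norml; case: (leP s c) => ?; case: (leP t c) => ?; apply/andP; split; lra.
Qed.

Lemma ler_dist_max (R : realDomainType) (c s t : R) :
  `|Num.max s c - Num.max t c| <= `|s - t|.
Proof.
have h1 := ler_norm (s - t); have := ler_norm (t - s); rewrite [`|t - s|]distrC => h2.
rewrite ler_norml; case: (leP s c) => ?; case: (leP t c) => ?; apply/andP; split; lra.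
Qed.

(** Serves to choose one time step or radius below all the positive bounds that a proof collects. *)
Lemma exists_pos_le (R : realDomainType) (s : seq R) : all (fun x => 0 < x) s ->
  exists2 k : R, 0 < k & all (fun x => k <= x) s.
Proof.
elim: s => [_|x s IH /= /andP[x0 /IH[k k0 ks]]]; first by exists 1.
exists (Num.min x k); first by rewrite lt_min x0.
rewrite ge_min lexx/=; apply: sub_all ks => y ky.
by rewrite ge_min ky orbT.
Qed.

Lemma norm_max (R : realType) (W : normedModType R) (u : R -> W) (a b : R) :
  a <= b -> continuous u ->
  exists2 q, a <= q <= b & forall t, a <= t <= b -> `|u t| <= `|u q|.
Proof.
move=> ab cu.
have [q qab h] := EVT_max ab (continuous_subspaceT (f := fun s => `|u s|) (A := `[a, b])
  (fun x => cvg_norm (cu x))).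
by exists q => [|t tab]; [rewrite in_itv in qab|apply: h; rewrite in_itv].
Qed.


Lemma geometric_small (R : realType) (C e : R) : 0 < e -> exists n, C * 2^-1 ^+ n < e.
Proof.
move=> e0; have C1 : 0 < `|C| + 1 by rewrite ltr_wpDl.
have half_lt1 : `|2^-1 : R| < 1 by rewrite ger0_norm// invf_lt1// ltr1n.
have /cvgrPdist_lt/(_ _ (divr_gt0 e0 C1)) h := cvg_expr half_lt1.
have [n] := filter_ex h; rewrite sub0r normrN ger0_norm ?exprn_ge0// ltr_pdivlMr// => hn.
exists n; apply: le_lt_trans hn; rewrite mulrC ler_wpM2l ?exprn_ge0//.
by rewrite (le_trans (ler_norm _))// lerDl.
Qed.

Section geometric_sequences.
Context {R : realType}.
Implicit Type C : R.

Lemma geometric_eq0 (V : normedModType R) (x : V) C :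
  (forall n, `|x| <= C * 2^-1 ^+ n) -> x = 0.
Proof.
move=> h; apply/eqP; rewrite -normr_le0; apply/ler_addgt0Pr => e e0; rewrite add0r.
by have [n hn] := geometric_small C e0; exact: le_trans (h n) (ltW hn).
Qed.

Lemma sum_geometric_le n : \sum_(k < n) 2^-1 ^+ k <= 2 :> R.
Proof.
have -> : \sum_(k < n) 2^-1 ^+ k = 2 * (1 - 2^-1 ^+ n) :> R.
  elim: n => [|n IH]; first by rewrite big_ord0 expr0 subrr mulr0.
  by rewrite big_ord_recr/= IH exprS; lra.
by rewrite ler_piMr// gerBl exprn_ge0.
Qed.

Lemma geometric_dist (V : normedModType R) (u : nat -> V) C i n :
  (forall n, `|u n.+1 - u n| <= C * 2^-1 ^+ n) -> `|u (n + i)%N - u i| <= 2 * C * 2^-1 ^+ i.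
Proof.
move=> uC; have C0 : 0 <= C.
  by have := le_trans (normr_ge0 _) (uC 0%N); rewrite expr0 mulr1.
apply: le_trans (_ : _ <= (\sum_(k < n) 2^-1 ^+ k) * (C * 2^-1 ^+ i)) _; last first.
  by rewrite -mulrA ler_wpM2r ?sum_geometric_le// mulr_ge0 ?exprn_ge0.
elim: n => [|n IH]; first by rewrite add0n subrr normr0 big_ord0 mul0r.
rewrite big_ord_recr/= mulrDl [leRHS]addrC addSn.
apply: le_trans (ler_norm_dist_triangle (u (n + i)%N) _ _) _; apply: lerD => //.
by rewrite mulrCA -exprD; exact: uC.
Qed.

Lemma geometric_cvg (V : completeNormedModType R) (u : nat -> V) C :
  (forall n, `|u n.+1 - u n| <= C * 2^-1 ^+ n) ->
  exists l, forall i, `|l - u i| <= 2 * C * 2^-1 ^+ i.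
Proof.
move=> uC; have ud i n := geometric_dist i n uC.
have /cauchy_cvgP/cvg_ex[l ul] : cauchy (u @ \oo).
  apply: cauchy_exP => e e0; have [N hN] := geometric_small (2 * C) e0.
  exists (u N); exists N => // n /= Nn; rewrite -ball_normE/= distrC -(subnK Nn).
  exact: le_lt_trans (ud _ _) hN.
exists l => i; apply/ler_addgt0Pr => e e0.
have /cvgrPdist_lt/(_ e e0)[N _ hN] := ul.
apply: le_trans (ler_norm_dist_triangle (u (N + i)%N) _ _) _; rewrite addrC lerD//.
by rewrite ltW//; apply: hN => /=; rewrite leq_addr.
Qed.

End geometric_sequences.

Lemma continuous_segment_bounded (R : realType) (W : normedModType R)
    (f : R -> W) (a b : R) : continuous f ->
  exists2 C : R, 0 <= C & forall s, a <= s <= b -> `|f s| <= C.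
Proof.
move=> cf; have [ba|ab] := ltP b a.
  by exists 0 => // s /andP[h1 h2]; have := le_lt_trans (le_trans h1 h2) ba; rewrite ltxx.
by have [q _ h] := norm_max ab cf; exists `|f q|.
Qed.

(** * Completeness of Lp *)

Lemma limn_einf_le (R : realType) (u : (\bar R)^nat) (C : \bar R) :
  (forall n, (u n <= C)%E) -> (limn_einf u <= C)%E.
Proof.
move=> uC; rewrite limn_einf_lim; apply: lime_le; first exact: is_cvg_einfs.
by apply: nearW => n; apply: le_trans (uC n); apply: ereal_inf_lbound; exists n => /=.
Qed.

Lemma limn_einf_ge0 (R : realType) (u : (\bar R)^nat) :
  (forall n, (0 <= u n)%E) -> (0 <= limn_einf u)%E.
Proof.
move=> u0; rewrite limn_einf_lim; apply: lime_ge; first exact: is_cvg_einfs.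
by apply: nearW => n; apply: le_ereal_inf_tmp => _ [k _ <-].
Qed.

Lemma measurable_fun_limn_einf d (T : measurableType d) (R : realType)
    (D : set T) (u : (T -> \bar R)^nat) :
  (forall n, measurable_fun D (u n)) ->
  measurable_fun D (fun x => limn_einf (u ^~ x)).
Proof.
move=> mu; apply: measurableT_comp => //.
by apply: (@measurable_fun_limn_esup _ _ _ D (fun n x => - u n x)%E) => n;
  exact: measurableT_comp.
Qed.

Lemma continuous_norm_powR (R : realType) (p : R) : 0 < p ->
  continuous (fun y : R => `|y| `^ p).
Proof.
move=> p0 y; have [->|y0] := eqVneq y 0.
  (* At 0 the power is not handled by differentiability; the radius e^(1/p) works directly. *)
  rewrite /continuous_at normr0 powR0 ?gt_eqF//; apply/cvgrPdist_lt => e e0.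
  exists (e `^ p^-1) => /=; first exact: powR_gt0.
  move=> z /=; rewrite sub0r normrN => ze.
  rewrite sub0r normrN ger0_norm ?powR_ge0//.
  rewrite -[ltRHS]powRr1 ?ltW// -(mulVf (lt0r_neq0 p0)) powRrM.
  by apply: gt0_ltr_powR; rewrite ?nnegrE// powR_ge0.
apply: (@continuous_comp _ _ _ (fun z : R => `|z|) (fun z => z `^ p)).
  exact: norm_continuous.
apply: differentiable_continuous; apply/derivable1_diffP.
by apply: derivable_powR; rewrite in_itv/= andbT normr_gt0.
Qed.

Section riesz_fischer.
Context d (T : measurableType d) (R : realType).
Variables (mu : {measure set T -> \bar R}) (p : R) (p1 : 1 <= p).
Implicit Types (f : T -> R) (h : (T -> R)^nat).

Let p_gt0 : 0 < p. Proof. exact: lt_le_trans p1. Qed.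

Let fatou_powR h C : (forall n, measurable_fun setT (h n)) ->
  (forall n, 'N[mu]_p%:E[EFin \o h n] <= C%:E)%E ->
  (\int[mu]_x limn_einf (fun n => (`|(h n x)%:E| `^ p)%E) <= (C%:E `^ p))%E.
Proof.
move=> mh hC; apply: le_trans (fatou _ _ _ _) _ => //.
  - by move=> n; apply: (measurable_abs_poweR p (mh n)).
  - by move=> n x _; exact: poweR_ge0.
apply: limn_einf_le => n; rewrite -(poweR_Lnorm mu (EFin \o h n) (lt0r_neq0 p_gt0)).
apply: gt0_ler_poweR; rewrite ?in_itv/= ?leey ?andbT ?Lnorm_ge0//; first exact: ltW.
exact: le_trans (Lnorm_ge0 _ _ _) (hC n).
Qed.

(** Almost everywhere the lower limit of |h_n|^p is |f|^p, so Fatou's lemma bounds the integral of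
    |f|^p by C^p; then p-th roots are taken. *)
Lemma Lnorm_fatou h f C : (forall n, measurable_fun setT (h n)) ->
  measurable_fun setT f -> {ae mu, forall x, h ^~ x @ \oo --> f x} ->
  (forall n, 'N[mu]_p%:E[EFin \o h n] <= C%:E)%E ->
  ('N[mu]_p%:E[EFin \o f] <= C%:E)%E.
Proof.
move=> mh mf hf hC.
have C0 : (0 <= C%:E)%E by exact: le_trans (Lnorm_ge0 mu p%:E (EFin \o h 0%N)) (hC 0%N).
have pneq0 : p != 0 by exact: lt0r_neq0.
have le_p : ('N[mu]_p%:E[EFin \o f] `^ p <= C%:E `^ p)%E.
  rewrite poweR_Lnorm//; apply: le_trans _ (fatou_powR mh hC).
  rewrite le_eqVlt; apply/orP; left; apply/eqP; apply: ae_eq_integral => //.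
  - exact: measurable_abs_poweR.
  - apply: measurable_fun_limn_einf => n; exact: measurable_abs_poweR.
  apply: filterS hf => x hx _; apply/esym.
  have cv : (`|(h n x)%:E| `^ p)%E @[n --> \oo] --> (`|(f x)%:E| `^ p)%E.
    rewrite /=; apply: cvg_EFin; first exact: nearW.
    exact: (@cvg_comp _ _ _ (fun n => h n x) (fun y : R => `|y| `^ p) _ _ _ hx
      (@continuous_norm_powR R p p_gt0 (f x))).
  by have [-> _] := cvg_limn_einf_sup cv.
have := @gt0_ler_poweR _ p^-1 _ _ _ _ _ le_p.
rewrite -!poweRrM mulfV// !poweRe1 ?Lnorm_ge0//; apply.
- by rewrite invr_ge0 ltW.
- by rewrite in_itv/= leey andbT poweR_ge0.
- by rewrite in_itv/= leey andbT lee_fin powR_ge0.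
Qed.

(** By Fatou's lemma the lower limit of the p-th powers of the partial sums of |h_k| is integrable,
    hence finite almost everywhere. Where the normed series diverges, this lower limit is
    infinite. *)
Lemma ae_cvg_series_normed h C : (forall n, measurable_fun setT (h n)) ->
  (forall n, 'N[mu]_p%:E[EFin \o (fun x => \sum_(k < n) `|h k x|)%R] <= C%:E)%E ->
  {ae mu, forall x, cvgn (series (h ^~ x))}.
Proof.
move=> mh hC; pose g n := (fun x => \sum_(k < n) `|h k x|).
have mg n : measurable_fun setT (g n).
  by apply: measurable_sum => k; apply: measurableT_comp.
have C0 : (0 <= C%:E)%E by exact: le_trans (Lnorm_ge0 mu p%:E (EFin \o g 0%N)) (hC 0%N).
have int_g : mu.-integrable setT (fun x => limn_einf (fun n => (`|(g n x)%:E| `^ p)%E)).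
  apply/integrableP; split.
    by apply: measurable_fun_limn_einf => n; exact: measurable_abs_poweR.
  apply: le_lt_trans (_ : _ <= C%:E `^ p)%E _; last by rewrite poweR_EFin ltry.
  apply: le_trans _ (fatou_powR mg hC); apply: ge0_le_integral => //.
  - apply: measurableT_comp => //.
    by apply: measurable_fun_limn_einf => n; exact: measurable_abs_poweR.
  - by apply: measurable_fun_limn_einf => n; exact: measurable_abs_poweR.
  - move=> x _; rewrite gee0_abs//; apply: limn_einf_ge0 => n; exact: poweR_ge0.
have := integrable_ae measurableT int_g; apply: filterS => x /(_ Logic.I) fin.
apply: normed_cvg.
have ge : g ^~ x = [normed series (h ^~ x)].
  by apply/funext => n; rewrite /g -(big_mkord xpredT (fun k => `|h k x|)).
rewrite -ge; apply: contrapT => /nondecreasing_dvgn_lt gdv.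
have {}gdv : g ^~ x @ \oo --> +oo.
  apply: gdv; rewrite ge; apply: nondecreasing_series => n _ _; exact: normr_ge0.
move: fin; suff -> : limn_einf (fun n => (`|(g n x)%:E| `^ p)%E) = +oo%E by [].
have cv : (`|(g n x)%:E| `^ p)%E @[n --> \oo] --> +oo%E.
  rewrite /=; apply/cvgeryP/cvgryPge => A; near=> n.
  (* The bound 1 is there because g <= g^p, for p >= 1, holds only when g >= 1. *)
  have : Num.max 1 A <= g n x by near: n; move/cvgryPge: gdv; apply.
  rewrite ge_max => /andP[g1 gA]; apply: le_trans gA _.
  rewrite (ger0_norm (le_trans ler01 g1)) -{1}(powRr1 (le_trans ler01 g1)).
  exact: ler_powR.
by have [-> _] := cvg_limn_einf_sup cv.
Unshelve. all: by end_near. Qed.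

End riesz_fischer.

(** A Cauchy filter contains a ball of radius 2^-n / 2 for each n. Two consecutive balls meet, both
    being in the filter, so their centres form a sequence with geometric increments, and its limit
    is a limit of the filter. *)
Lemma fast_cauchy_complete (R : realType) (V : normedModType R) :
  (forall u : nat -> V, (forall n, `|u n.+1 - u n| <= 2^-1 ^+ n) ->
    exists l : V, u @ \oo --> l) ->
  forall F : set_system V, ProperFilter F -> cauchy F -> cvg F.
Proof.
move=> Vc F FF /cauchyP Fc.
have e0 n : (0 : R) < 2^-1 ^+ n / 2 by rewrite divr_gt0// exprn_gt0// invr_gt0.
have /choice[u Fu] n : exists x, F (ball x (2^-1 ^+ n / 2)) := Fc _ (e0 n).
have [n|l ul] := Vc u.
  have [z [zn zn1]] := filter_ex (filterI (Fu n) (Fu n.+1)).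
  rewrite -ball_normE/= in zn zn1.
  apply: le_trans (ler_norm_dist_triangle z _ _) _; rewrite [leRHS]splitr lerD//.
    apply: ltW; apply: lt_le_trans zn1 _.
    by rewrite ler_pM2r ?invr_gt0// exprS ler_piMl// invf_le1// ler1n.
  by rewrite distrC ltW.
apply/cvg_ex; exists l; apply/cvgrPdist_lt => e e_gt0.
have e2 : 0 < e / 2 by rewrite divr_gt0.
have /cvgrPdist_lt/(_ _ e2)[N1 _ h1] := ul.
have [N2 h2] := geometric_small 1 e2.
pose N := maxn N1 N2.
apply: filterS (Fu N) => x; rewrite -ball_normE/= => uNx.
apply: le_lt_trans (ler_norm_dist_triangle (u N) _ _) _; rewrite [ltRHS]splitr ltrD//.
  by apply: h1; rewrite /= leq_maxl.
apply: lt_trans uNx _; apply: le_lt_trans h2; rewrite mul1r.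
apply: le_trans (_ : _ <= 2^-1 ^+ N) _.
  by rewrite ler_piMr ?exprn_ge0// invf_le1// ler1n.
by apply: ler_wiXn2l; rewrite ?leq_maxr ?invf_le1 ?ler1n.
Qed.

Section Lspace_complete.
Context d (T : measurableType d) (R : realType).
Variables (mu : {measure set T -> \bar R}) (p : R) (p1 : (1 <= p%:E)%E).
Local Notation L := (LspaceType mu p1).

Let p1' : 1 <= p. Proof. by rewrite -lee_fin. Qed.

Lemma Lspace_normE (f : L) : `|f|%:E = 'N[mu]_p%:E[EFin \o (f : T -> R)]%E.
Proof. exact: (finite_norm_fine (Lfun_Sub p1 (Lspace_Lfun f))). Qed.

Lemma Lspace_subE (f g : L) : (f - g : T -> R) = (f : T -> R) \- g %[ae mu].
Proof.
have e1 := Lspace_addE f (- g).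
have e2 := Lspace_scaleE (-1) g.
move: e1 e2; apply: filterS2 => x /(_ Logic.I) e1 /(_ Logic.I) e2 _.
by rewrite e1 -[- g]scaleN1r !fctE e2 !fctE scaleN1r.
Qed.

Lemma Lspace_norm_subE (f g : L) :
  `|f - g|%:E = 'N[mu]_p%:E[EFin \o ((f : T -> R) \- g)%R]%E.
Proof.
rewrite Lspace_normE; apply: Lnorm_ae => //.
- exact: measurable_Lspace.
- by apply: measurable_funB; exact: measurable_Lspace.
- exact: Lspace_subE.
Qed.

(** Riesz-Fischer: by Minkowski the partial sums of the absolute increments have norm at most 2, so
    the representatives converge almost everywhere. Fatou's lemma turns this into convergence in
    norm. *)
Lemma Lspace_fast_cauchy (u : nat -> L) :
  (forall n, `|u n.+1 - u n| <= 2^-1 ^+ n) -> exists l : L, u @ \oo --> l.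
Proof.
move=> uC; pose h n : T -> R := (u n.+1 : T -> R) \- u n.
have mu_ n : measurable_fun setT (u n : T -> R) by exact: measurable_Lspace.
have mh n : measurable_fun setT (h n) by exact: measurable_funB.
have ae_cv : {ae mu, forall x, cvgn (series (h ^~ x))}.
  apply: (@ae_cvg_series_normed _ _ _ mu p p1' h 2) => // n.
  apply: le_trans (_ : _ <= (\sum_(k < n) 2^-1 ^+ k)%:E)%E _; last by rewrite lee_fin sum_geometric_le.
  elim: n => [|n IH].
    rewrite big_ord0 [X in 'N[_]__[X]%E](_ : _ = cst 0%E) ?Lnorm0//.
      by rewrite eqe gt_eqF// (lt_le_trans _ p1').
    by apply/funext => x /=; rewrite big_ord0.
  rewrite big_ord_recr/= EFinD.
  rewrite [X in 'N[_]__[X]%E](_ : _ =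
      (EFin \o ((fun x => \sum_(k < n) `|h k x|) \+ (fun x => `|h n x|)))); last first.
    by apply/funext => x /=; rewrite big_ord_recr.
  apply: le_trans (eminkowski mu _ _ p1) _ => //.
  - by apply: measurable_sum => k; exact: measurableT_comp.
  - exact: measurableT_comp.
  apply: leeD => //.
  have -> : EFin \o (fun x => `|h n x|) = abse \o (EFin \o h n) by [].
  by rewrite Lnorm_abse -Lspace_norm_subE lee_fin.
(* An upper limit is measurable on the whole space and agrees with the limit wherever the latter
   exists; [fine] gives 0 at infinite values. *)
pose f x := fine (limn_esup (fun n => (u n x)%:E)).
have mf : measurable_fun setT f.
  apply: measurableT_comp => //.
  by apply: measurable_fun_limn_esup => n; exact: measurableT_comp.
have ae_lim : {ae mu, forall x, (fun n => u n x) @ \oo --> f x}.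
  apply: filterS ae_cv => x cx.
  have uE : (fun n => (u n : T -> R) x) = (fun n => (u 0%N : T -> R) x + series (h ^~ x) n).
    apply/funext => n; rewrite /series/=; elim: n => [|n IH].
      by rewrite big_nil addr0.
    by rewrite big_nat_recr//= addrA -IH /h subrKC.
  have cu : cvgn (fun n => (u n : T -> R) x).
    by rewrite uE; apply: is_cvgD => //; exact: is_cvg_cst.
  suff -> : f x = limn (fun n => (u n : T -> R) x) by [].
  rewrite /f; have cE : (fun n => (u n x)%:E) @ \oo --> (limn (fun n => (u n : T -> R) x))%:E.
    by apply: cvg_EFin => //; exact: nearW.
  by have [_ ->] := cvg_limn_einf_sup cE.
have u_ij i n : `|u (n + i)%N - u i| <= 2 * 2^-1 ^+ i.
  have := @geometric_dist _ _ u 1 i n; rewrite mulr1; apply => k.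
  by rewrite mul1r.
(* Fatou's lemma along n with i fixed. The case i = 0 shows that [f] has finite norm, large i that
   [u i] tends to it. *)
have fB i : ('N[mu]_p%:E[EFin \o (f \- u i)%R] <= (2 * 2^-1 ^+ i)%:E)%E.
  apply: (@Lnorm_fatou _ _ _ mu p p1' (fun n => (u (n + i)%N : T -> R) \- u i)).
  - by move=> n; exact: measurable_funB.
  - exact: measurable_funB.
  - apply: filterS ae_lim => x cx; apply: cvgB; last exact: cvg_cst.
    by rewrite (cvg_shiftn i (fun n => (u n : T -> R) x)).
  - by move=> n; rewrite -Lspace_norm_subE lee_fin.
have fL : f \in Lfun mu p%:E.
  apply/andP; split; rewrite inE//= /finite_norm.
  have -> : EFin \o f = EFin \o ((f \- u 0%N) \+ u 0%N)%R.
    by apply/funext => x; rewrite /= subrK.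
  apply: le_lt_trans (eminkowski mu _ _ p1) _ => //; first exact: measurable_funB.
  rewrite -Lspace_normE; apply: lte_add_pinfty; last exact: ltry.
  by apply: le_lt_trans (fB 0%N) _; exact: ltry.
exists (Lclass p1 fL); apply/cvgrPdist_le => e e0.
have [N hN] := geometric_small 2 e0; exists N => // n /= Nn.
rewrite -lee_fin Lspace_norm_subE.
rewrite (@Lnorm_ae _ _ _ mu p%:E p1 _ (f \- u n)).
- apply: le_trans (fB n) _; rewrite lee_fin; apply: le_trans _ (ltW hN).
  by rewrite ler_wpM2l//; apply: ler_wiXn2l; rewrite ?invf_le1 ?ler1n.
- by apply: measurable_funB => //; exact: measurable_Lspace.
- exact: measurable_funB.
- have := LclassE p1 fL; apply: filterS => x /(_ Logic.I) e1 _.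
  by rewrite /= e1.
Qed.

Lemma Lspace_complete (F : set_system L) : ProperFilter F -> cauchy F -> cvg F.
Proof. by apply: fast_cauchy_complete; exact: Lspace_fast_cauchy. Qed.

End Lspace_complete.

(** Makes [L2 Omega] a [completeNormedModType], the setting in which integrals, semigroups and
    solutions are treated below. *)
HB.instance Definition _ (R : realType) (n : nat) (Omega : smooth_bounded_domain R n) :=
  Uniform_isComplete.Build (L2 Omega)
    (@Lspace_complete _ _ _ (domain_measure Omega) 2 (lee1n 2)).

(** * The Riemann integral of continuous curves *)

Section riemann_sums.
Context {R : realType}.
Implicit Types (a b k : R) (m : nat) (x tag : nat -> R).

(** The partitions over which [is_RInt] quantifies, with mesh below [k]. *)
Definition tagged_partition a b k m x tag :=
  [/\ x 0%N = a, x m = b &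
      forall i, (i < m)%N -> x i <= tag i <= x i.+1 /\ x i.+1 - x i < k].

Lemma tagged_partition_mono a b k m x tag : tagged_partition a b k m x tag ->
  forall i j, (i <= j)%N -> (j <= m)%N -> x i <= x j.
Proof.
move=> [_ _ P] i; elim=> [|j IH]; first by rewrite leqn0 => /eqP->.
rewrite leq_eqVlt => /predU1P[->//|ij jm].
apply: le_trans (IH ij (ltnW jm)) _.
by have [/andP[h1 h2] _] := P _ jm; exact: le_trans h2.
Qed.

Lemma tagged_partition_itv a b k m x tag i : tagged_partition a b k m x tag ->
  (i <= m)%N -> a <= x i <= b.
Proof.
move=> P im; have mono := tagged_partition_mono P.
by case: (P) => <- <- _; rewrite !mono.
Qed.

Lemma tagged_partition_tag a b k m x tag i : tagged_partition a b k m x tag ->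
  (i < m)%N -> a <= tag i <= b.
Proof.
move=> P im; have /andP[h1 _] := tagged_partition_itv P (ltnW im).
have /andP[_ h2] := tagged_partition_itv P im.
have [_ _ /(_ _ im)[/andP[h3 h4] _]] := P.
by rewrite (le_trans h1)//= (le_trans h4).
Qed.

Lemma tagged_partition_exists a b k : 0 < k -> a <= b ->
  exists m x tag, tagged_partition a b k m x tag.
Proof.
move=> k0 ab; pose m := (Num.truncn ((b - a) / k)).+1.
have m0 : 0 < m%:R :> R by rewrite ltr0n.
pose x i := a + (b - a) / m%:R * i%:R.
have dx i : x i.+1 - x i = (b - a) / m%:R.
  by rewrite /x -[i.+1]addn1 natrD; ring.
exists m, x, x; split=> [||i _].
- by rewrite /x mulr0 addr0.
- by rewrite /x divfK ?gt_eqF// subrKC.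
- rewrite lexx/= dx -subr_ge0 dx; split; first by rewrite divr_ge0// subr_ge0.
  by rewrite ltr_pdivrMr// mulrC -ltr_pdivrMr//; exact: truncnS_gt.
Qed.

Definition clip lo hi y : R := Num.max lo (Num.min y hi).

Definition overlap x y (i j : nat) : R :=
  Num.max 0 (Num.min (x i.+1) (y j.+1) - Num.max (x i) (y j)).

Lemma overlap_sym x y i j : overlap x y i j = overlap y x j i.
Proof. by rewrite /overlap minC maxC [Num.max (x i) _]maxC maxC. Qed.

Lemma overlap_ge0 x y i j : 0 <= overlap x y i j.
Proof. by rewrite le_max lexx. Qed.

Lemma overlap_neq0 x y i j : overlap x y i j != 0 -> y j < x i.+1 /\ x i < y j.+1.
Proof.
rewrite /overlap; case: (leP 0) => [h|_]; last by rewrite eqxx.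
move=> h0; have {h0 h} : 0 < Num.min (x i.+1) (y j.+1) - Num.max (x i) (y j).
  by rewrite lt_neqAle eq_sym h0.
by rewrite subr_gt0 lt_min !gt_max => /andP[/andP[_ ->] /andP[-> _]].
Qed.

(** As an increment of [clip (x i) (x i.+1)] along [y], the overlap telescopes when summed over
    [j]. *)
Lemma overlap_clip x y i j : x i <= x i.+1 -> y j <= y j.+1 ->
  overlap x y i j = clip (x i) (x i.+1) (y j.+1) - clip (x i) (x i.+1) (y j).
Proof.
rewrite /overlap /clip; move: (x i) (x i.+1) (y j) (y j.+1) => p q s t pq st.
rewrite [Num.min q t]minC; have [ps|sp] := leP p s.
  have [sq|qs] := leP s q.
    have sm : s <= Num.min t q by rewrite le_min st.
    by rewrite (max_r (le_trans ps sm)) (max_r ps) max_r// subr_ge0.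
  rewrite (min_r (ltW (lt_le_trans qs st))) subrr max_l// subr_le0; exact: ltW.
rewrite (min_l (ltW (lt_le_trans sp pq))) (max_l (ltW sp)).
have [pm|mp] := leP p (Num.min t q); first by rewrite max_r// subr_ge0.
by rewrite subrr max_l// subr_le0 ltW.
Qed.

Lemma sum_overlap a b k x m y tag i : tagged_partition a b k m y tag ->
  x i <= x i.+1 -> a <= x i -> x i.+1 <= b -> \sum_(j < m) overlap x y i j = x i.+1 - x i.
Proof.
move=> Q xi ax xb; have [y0 ym _] := Q.
have yle (j : 'I_m) : y j <= y j.+1 by apply: (tagged_partition_mono Q).
under eq_bigr => j _ do rewrite overlap_clip//.
rewrite -(big_mkord xpredT (fun j => clip _ _ (y j.+1) - clip _ _ (y j))).
rewrite (telescope_sumr (fun j => clip (x i) (x i.+1) (y j)))// y0 ym /clip.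
move: (x i) (x i.+1) xi ax xb => p q pq ap qb.
by rewrite (min_r qb) (min_l (le_trans ap pq)) (max_r pq) (max_l ap).
Qed.

Variable H : normedModType R.
Implicit Type f : R -> H.

Definition riemann_sum f m x tag : H := \sum_(i < m) (x i.+1 - x i) *: f (tag i).

(* Both sums are refined to the intersections of [x i, x i.+1] and [y j, y j.+1],
   of length [overlap x y i j]. *)
Lemma riemann_sum_dist f a b k k' e m x tag n y tag' :
  (forall s t, a <= s <= b -> a <= t <= b -> `|s - t| <= k + k' -> `|f s - f t| <= e) ->
  0 <= e -> tagged_partition a b k m x tag -> tagged_partition a b k' n y tag' ->
  `|riemann_sum f m x tag - riemann_sum f n y tag'| <= e * (b - a).
Proof.
move=> fe e0 P Q.
have xle (i : 'I_m) : x i <= x i.+1 by apply: (tagged_partition_mono P).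
have yle (j : 'I_n) : y j <= y j.+1 by apply: (tagged_partition_mono Q).
have xab (i : 'I_m) : a <= x i /\ x i.+1 <= b.
  have /andP[h1 _] := tagged_partition_itv P (ltnW (ltn_ord i)).
  by have /andP[_ h2] := tagged_partition_itv P (ltn_ord i).
have yab (j : 'I_n) : a <= y j /\ y j.+1 <= b.
  have /andP[h1 _] := tagged_partition_itv Q (ltnW (ltn_ord j)).
  by have /andP[_ h2] := tagged_partition_itv Q (ltn_ord j).
have -> : riemann_sum f m x tag = \sum_(i < m) \sum_(j < n) overlap x y i j *: f (tag i).
  apply: eq_bigr => i _; rewrite -scaler_suml; congr (_ *: _).
  by have [h1 h2] := xab i; rewrite (sum_overlap Q).
have -> : riemann_sum f n y tag' = \sum_(i < m) \sum_(j < n) overlap x y i j *: f (tag' j).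
  rewrite exchange_big; apply: eq_bigr => j _; rewrite -scaler_suml; congr (_ *: _).
  have [h1 h2] := yab j; rewrite -(sum_overlap P)//.
  by apply: eq_bigr => i _; rewrite overlap_sym.
rewrite -sumrB.
under eq_bigr do rewrite -sumrB.
apply: le_trans (_ : _ <= \sum_(i < m) \sum_(j < n) overlap x y i j * e) _.
  apply: le_trans (ler_norm_sum _ _ _) _; apply: ler_sum => i _.
  apply: le_trans (ler_norm_sum _ _ _) _; apply: ler_sum => j _.
  rewrite -scalerBr normrZ ger0_norm ?overlap_ge0//.
  have [->|o0] := eqVneq (overlap x y i j) 0; first by rewrite !mul0r.
  apply: ler_wpM2l; first exact: overlap_ge0.
  apply: fe; [exact: tagged_partition_tag P _|exact: tagged_partition_tag Q _|].
  have [yx xy] := overlap_neq0 o0.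
  have [_ _ /(_ _ (ltn_ord i))[/andP[t1 t2] t3]] := P.
  have [_ _ /(_ _ (ltn_ord j))[/andP[t4 t5] t6]] := Q.
  by rewrite ler_norml; lra.
under eq_bigr do rewrite -mulr_suml.
rewrite -mulr_suml mulrC ler_wpM2l// le_eqVlt; apply/orP; left; apply/eqP.
under eq_bigr => i _ do (rewrite (sum_overlap Q) //; [|by case: (xab i)|by case: (xab i)]).
rewrite -(big_mkord xpredT (fun i => x i.+1 - x i)) telescope_sumr//.
by case: P => -> -> _.
Qed.

End riemann_sums.

Section riemann_integral.
Context {R : realType} {H : completeNormedModType R}.
Implicit Types (f g : R -> H) (a b c : R) (I J : H).

Lemma is_RIntP f a b I : is_RInt f a b I <-> forall e, 0 < e ->
  exists2 k, 0 < k & forall m x tag, tagged_partition a b k m x tag ->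
    `|riemann_sum f m x tag - I| < e.
Proof.
by split=> fI e /fI[k k0 h]; exists k => // m x tag; [move=> [*]|move=> *]; exact: h.
Qed.

Lemma is_RInt_approx f a b I e k' : is_RInt f a b I -> a <= b -> 0 < e -> 0 < k' ->
  exists m x tag, tagged_partition a b k' m x tag /\ `|riemann_sum f m x tag - I| < e.
Proof.
move=> /is_RIntP fI ab e0 k'0; have [k k0 h] := fI e e0.
have kk0 : 0 < Num.min k k' by rewrite lt_min k0.
have [m [x [tag [x0 xm P]]]] := tagged_partition_exists kk0 ab.
exists m, x, tag; split.
  by split=> // i /P[? +]; rewrite lt_min => /andP[].
by apply: h; split=> // i /P[? +]; rewrite lt_min => /andP[].
Qed.

(** By uniform continuity any two sums of fine enough mesh are close. Hence the sums over partitions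
    of mesh below 1/(n+1) are Cauchy, and every fine sum is near their limit. *)
Lemma is_RInt_exists f a b : continuous f -> a <= b -> exists I, is_RInt f a b I.
Proof.
move=> cf ab.
have uf e : 0 < e -> exists2 k, 0 < k & forall m x tag n y tag',
    tagged_partition a b k m x tag -> tagged_partition a b k n y tag' ->
    `|riemann_sum f m x tag - riemann_sum f n y tag'| <= e.
  (* The [+ 1] keeps the denominator positive when [a = b]. *)
  move=> e0; have e'0 : 0 < e / (b - a + 1) by rewrite divr_gt0// ltr_wpDl// subr_ge0.
  have [k k0 fk] := uniform_continuous_segment a b cf e'0.
  exists (k / 2); first exact: divr_gt0.
  move=> m x tag n y tag' P Q.
  apply: le_trans (riemann_sum_dist _ (ltW e'0) P Q) _.
    by move=> s t sab tab; rewrite -splitr distrC => st; rewrite distrC; exact: fk.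
  rewrite mulrAC ler_pdivrMr ?ltr_wpDl ?subr_ge0// ler_wpM2l ?lerDl//.
  exact: ltW.
have /choice[P HP] n : exists p : nat * (nat -> R) * (nat -> R),
    tagged_partition a b (harmonic n) p.1.1 p.1.2 p.2.
  have [m [x [tag h]]] := tagged_partition_exists (harmonic_gt0 n) ab.
  by exists (m, x, tag).
pose S n := riemann_sum f (P n).1.1 (P n).1.2 (P n).2.
have fine_eventually k : 0 < k -> \forall n \near \oo,
    tagged_partition a b k (P n).1.1 (P n).1.2 (P n).2.
  move=> k0; have /cvgrPdist_lt/(_ k k0) := @cvg_harmonic R.
  apply: filterS => n; rewrite sub0r normrN ger0_norm ?harmonic_ge0// => nk.
  by have [x0 xm h] := HP n; split=> // i /h[? /lt_trans]; split=> //; auto.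
have /cauchy_cvgP/cvg_ex[I SI] : cauchy (S @ \oo).
  apply: cauchy_exP => e e0; have [k k0 hk] := uf (e / 2) (divr_gt0 e0 (ltr0n _ 2)).
  have F := fine_eventually k k0; have [n Pn] := filter_ex F.
  exists (S n); apply: filterS F => i Pi; rewrite /= -ball_normE/=.
  by apply: le_lt_trans (hk _ _ _ _ _ _ Pn Pi) _; rewrite ltr_pdivrMr// ltr_pMr// ltr1n.
exists I; apply/is_RIntP => e e0.
have [k k0 hk] := uf (e / 2) (divr_gt0 e0 (ltr0n _ 2)).
exists k => // m x tag Q.
have /cvgrPdist_lt/(_ (e / 2) (divr_gt0 e0 (ltr0n _ 2))) SIe := SI.
have [n [nI Pn]] := filter_ex (filterI SIe (fine_eventually k k0)).
apply: le_lt_trans (ler_norm_dist_triangle (S n) _ _) _; rewrite [ltRHS]splitr.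
by apply: ler_ltD; [exact: hk|rewrite distrC].
Qed.

Lemma is_RInt_unique f a b I J : a <= b -> is_RInt f a b I -> is_RInt f a b J -> I = J.
Proof.
move=> ab fI /is_RIntP fJ; apply/eqP; rewrite -subr_eq0 -normr_le0.
apply/ler_addgt0Pr => e e0; rewrite add0r.
have e20 : 0 < e / 2 by rewrite divr_gt0.
have [k k0 hk] := fJ _ e20.
have [m [x [tag [P h]]]] := is_RInt_approx fI ab e20 k0.
apply: le_trans (ler_norm_dist_triangle (riemann_sum f m x tag) _ _) _.
by rewrite [leRHS]splitr ltW// ltrD// ?hk// distrC.
Qed.

(** Tags lie in [[a, b]], so an integrand may be altered outside. This is what allows extending
    integrands continuously to all of [R]. *)
Lemma is_RInt_ext f g a b I : (forall s, a <= s <= b -> f s = g s) ->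
  is_RInt f a b I -> is_RInt g a b I.
Proof.
move=> fg /is_RIntP fI; apply/is_RIntP => e e0; have [k k0 h] := fI e e0.
exists k => // m x tag P; have := h _ _ _ P; rewrite /riemann_sum.
by under eq_bigr => i _ do rewrite fg ?(tagged_partition_tag P)//.
Qed.

Lemma is_RIntB f g a b I J :
  is_RInt f a b I -> is_RInt g a b J -> is_RInt (fun s => f s - g s) a b (I - J).
Proof.
move=> /is_RIntP fI /is_RIntP gJ; apply/is_RIntP => e e0.
have e20 : 0 < e / 2 by rewrite divr_gt0.
have [k k0 h] := fI _ e20; have [k' k'0 h'] := gJ _ e20.
exists (Num.min k k'); first by rewrite lt_min k0.
move=> m x tag [x0 xm P].
have -> : riemann_sum (fun s => f s - g s) m x tag =
    riemann_sum f m x tag - riemann_sum g m x tag.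
  by rewrite /riemann_sum -sumrB; apply: eq_bigr => i _; rewrite scalerBr.
rewrite opprB [J - I]addrC addrACA [_ + J]addrC.
apply: le_lt_trans (ler_normD _ _) _; rewrite [ltRHS]splitr; apply: ltrD.
  by apply: h; split=> // i /P[? +]; rewrite lt_min => /andP[].
by rewrite distrC; apply: h'; split=> // i /P[? +]; rewrite lt_min => /andP[].
Qed.

Lemma is_RInt_linear (T : H -> H) (M : R) f a b I :
  (forall (c : R) x y, T (c *: x + y) = c *: T x + T y) ->
  (forall x, `|T x| <= M * `|x|) ->
  is_RInt f a b I -> is_RInt (fun s => T (f s)) a b (T I).
Proof.
move=> linT bT /is_RIntP fI; apply/is_RIntP => e e0.
have M0 : 0 < `|M| + 1 by rewrite ltr_wpDl.
have T0 : T 0 = 0.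
  by apply/eqP; rewrite -normr_le0; apply: le_trans (bT 0) _; rewrite normr0 mulr0.
have [k k0 h] := fI (e / (`|M| + 1)) (divr_gt0 e0 M0); exists k => // m x tag P.
have -> : riemann_sum (fun s => T (f s)) m x tag = T (riemann_sum f m x tag).
  rewrite /riemann_sum; elim: {P}m => [|m IH]; first by rewrite !big_ord0.
  by rewrite !big_ord_recr/= IH addrC -linT addrC.
have -> : T (riemann_sum f m x tag) - T I = T (riemann_sum f m x tag - I).
  by have := linT (-1) I (riemann_sum f m x tag); rewrite !scaleN1r [in LHS]addrC [RHS]addrC.
apply: le_lt_trans (bT _) _.
apply: le_lt_trans (_ : _ <= (`|M| + 1) * `|riemann_sum f m x tag - I|) _.
  by rewrite ler_wpM2r// (le_trans (ler_norm M))// lerDl.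
by rewrite -ltr_pdivlMl// mulrC; exact: h.
Qed.

Lemma is_RInt_norm f a b I C : a <= b -> (forall s, a <= s <= b -> `|f s| <= C) ->
  is_RInt f a b I -> `|I| <= C * (b - a).
Proof.
move=> ab fC fI; apply/ler_addgt0Pr => e e0.
have [m [x [tag [P h]]]] := is_RInt_approx fI ab e0 ltr01.
rewrite -[I](subrK (riemann_sum f m x tag)) addrC.
apply: le_trans (ler_normD _ _) _; rewrite distrC.
apply: lerD; last exact: ltW.
apply: le_trans (ler_norm_sum _ _ _) _.
apply: le_trans (_ : _ <= \sum_(i < m) C * (x i.+1 - x i)) _.
  apply: ler_sum => i _; rewrite normrZ ger0_norm; last first.
    by rewrite subr_ge0 (tagged_partition_mono P).
  rewrite mulrC ler_wpM2r ?subr_ge0 ?(tagged_partition_mono P)//.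
  exact/fC/(tagged_partition_tag P).
rewrite -mulr_sumr -(big_mkord xpredT (fun i => x i.+1 - x i)) telescope_sumr//.
by case: P => -> -> _.
Qed.

Lemma is_RInt_shift f a b c I :
  is_RInt f (a + c) (b + c) I -> is_RInt (fun s => f (s + c)) a b I.
Proof.
move=> /is_RIntP fI; apply/is_RIntP => e e0; have [k k0 h] := fI e e0.
exists k => // m x tag [x0 xm P].
have := h m (fun i => x i + c) (fun i => tag i + c).
rewrite /riemann_sum; under eq_bigr do rewrite opprD addrACA subrr addr0.
apply; split=> [||i /P[tP xk]]; rewrite ?x0 ?xm// !lerD2r; split=> //.
by rewrite opprD addrACA subrr addr0.
Qed.

Lemma is_RInt_split f a c b I J K : a <= c -> c <= b ->
  is_RInt f a c I -> is_RInt f c b J -> is_RInt f a b K -> K = I + J.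
Proof.
move=> ac cb fI fJ /is_RIntP fK.
apply/eqP; rewrite -subr_eq0 -normr_le0; apply/ler_addgt0Pr => e e0; rewrite add0r.
have e30 : 0 < e / 3 by rewrite divr_gt0.
have [k k0 hk] := fK _ e30.
have [m [x [tag [P h1]]]] := is_RInt_approx fI ac e30 k0.
have [n [y [tag' [Q h2]]]] := is_RInt_approx fJ cb e30 k0.
(* Concatenation of the two partitions. The index [m] belongs to both, consistently since
   [x m = c = y 0]. *)
pose z i := if (i <= m)%N then x i else y (i - m)%N.
pose w i := if (i < m)%N then tag i else tag' (i - m)%N.
have zl i : (i <= m)%N -> z i = x i by rewrite /z => ->.
have zr i : z (m + i)%N = y i.
  rewrite /z addKn; case: ifPn => //; rewrite -[leqRHS]addn0 leq_add2l leqn0 => /eqP->.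
  by case: P Q => _ + _ [+ _ _]; rewrite addn0 => -> ->.
have wl i : (i < m)%N -> w i = tag i by rewrite /w => ->.
have wr i : w (m + i)%N = tag' i by rewrite /w addKn ltnNge leq_addr.
have PQ : tagged_partition a b k (m + n) z w.
  split=> [||i imn]; first by rewrite zl//; case: P.
    by rewrite zr; case: Q.
  have [im|mi] := ltnP i m.
    by rewrite wl// zl ?(ltnW im)// zl//; case: P => _ _; exact.
  rewrite -(subnKC mi) -addnS !zr wr; case: Q => _ _; apply.
  by rewrite -(ltn_add2l m) subnKC.
have S12 : riemann_sum f (m + n) z w = riemann_sum f m x tag + riemann_sum f n y tag'.
  rewrite /riemann_sum big_split_ord/=; congr (_ + _); apply: eq_bigr => i _.
    by rewrite wl// zl// zl// ltnW.
  by rewrite -addnS !zr wr.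
apply: le_trans (ler_norm_dist_triangle (riemann_sum f (m + n) z w) _ _) _.
rewrite [X in X + _]distrC {2}S12 opprD addrACA.
apply: le_trans (lerD (ltW (hk _ _ _ PQ)) (ler_normD _ _)) _.
by have := lerD (ltW h1) (ltW h2); lra.
Qed.

End riemann_integral.

(** * Strongly continuous semigroups *)

Section semigroup.
Context {R : realType} {H : completeNormedModType R} (E : R -> H -> H).
Hypothesis C0E : C0_semigroup E.
Implicit Types (f : R -> H) (x y : H) (s t : R).

Let cE t : 0 <= t -> continuous (E t). Proof. by case: C0E => + _ _ _ => /(_ t) h /h[]. Qed.

Let lE t : 0 <= t -> forall (a : R) x y, E t (a *: x + y) = a *: E t x + E t y.
Proof. by case: C0E => + _ _ _ => /(_ t) h /h[]. Qed.

Lemma semigroup0 x : E 0 x = x. Proof. by case: C0E. Qed.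

Lemma semigroupD s t x : 0 <= s -> 0 <= t -> E (s + t) x = E s (E t x).
Proof. by case: C0E => _ _ + _ => h s0 t0; exact: h. Qed.

Lemma semigroup_linear0 t : 0 <= t -> E t 0 = 0.
Proof.
by move=> t0; have := lE t0 (-1) 0 0; rewrite !scaleN1r !addNr => ->.
Qed.

Lemma semigroup_linearB t x y : 0 <= t -> E t (x - y) = E t x - E t y.
Proof.
by move=> t0; have := lE t0 (-1) y x; rewrite !scaleN1r [in LHS]addrC [RHS]addrC.
Qed.

Lemma semigroup_linearZ t (a : R) x : 0 <= t -> E t (a *: x) = a *: E t x.
Proof. by move=> t0; have := lE t0 a x 0; rewrite semigroup_linear0// !addr0. Qed.

(** The scalar [c] brings every point of norm at most [r] within distance k/2 of 0, where continuity
    of [E t] bounds the image by 1. The conclusion has the form that [Banach_Steinhaus] expects. *)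
Let bounded_at t : 0 <= t -> bounded_fun_norm (E t).
Proof.
move=> t0 r; have [k k0 h] := (continuous_distP _).1 (cE t0) 0 1 ltr01.
pose c := k / 2 / (`|r| + 1).
have r0 : 0 < `|r| + 1 by rewrite ltr_wpDl.
have c0 : 0 < c by rewrite !divr_gt0.
exists c^-1 => x xr.
have : `|E t (c *: x) - E t 0| < 1.
  apply: h; rewrite subr0 normrZ gtr0_norm// /c mulrAC ltr_pdivrMr//.
  apply: le_lt_trans (_ : _ <= k / 2 * (`|r| + 1)) _; last first.
    by rewrite ltr_pM2r// ltr_pdivrMr// ltr_pMr// ltr1n.
  by rewrite ler_pM2l ?divr_gt0// (le_trans xr)// (le_trans (ler_norm _))// lerDl.
rewrite semigroup_linear0// subr0 semigroup_linearZ// normrZ gtr0_norm// => /ltW.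
by rewrite -ler_pdivlMl// mulr1.
Qed.

(** Otherwise there are times t_n <= 1/(n+1) and points x_n with |E t_n x_n| > (n+1) |x_n|. Each
    sequence E t_n x converges to x, so these operators are pointwise bounded, hence uniformly
    bounded, a contradiction. *)
Let bounded_near0 : exists k M, [/\ 0 < k, 1 <= M &
  forall t, 0 <= t <= k -> forall x, `|E t x| <= M * `|x|].
Proof.
apply: contrapT => nb.
have /choice[p hp] n : exists p : R * H,
    0 <= p.1 <= harmonic n /\ n.+1%:R * `|p.2| < `|E p.1 p.2|.
  apply: contrapT => np; apply: nb; exists (harmonic n), n.+1%:R; split.
  - exact: harmonic_gt0.
  - by rewrite ler1n.
  - by move=> t tn x; rewrite leNgt; apply/negP => h; apply: np; exists (t, x).
have p0 n : 0 <= (p n).1 by have [/andP[]] := hp n.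
have cvgE x : (fun n => E (p n).1 x) @ \oo --> x.
  apply/cvgrPdist_lt => e e0; have [_ _ _ /(_ x)/cvgrPdist_lt/(_ e e0)] := C0E.
  move=> [k /= k0 hk]; have /cvgrPdist_lt/(_ k k0) := @cvg_harmonic R.
  apply: filterS => n; rewrite sub0r normrN ger0_norm ?harmonic_ge0// => nk.
  (* The limit at [0^'+] says nothing of time 0 itself, where [E 0] is the identity. *)
  have [/andP[pn0 pnn] _] := hp n; move: pn0; rewrite le_eqVlt => /predU1P[<-|pn0].
    by rewrite semigroup0 subrr normr0.
  by apply: hk => //=; rewrite sub0r normrN gtr0_norm// (le_lt_trans pnn).
have [||M hM] := @Banach_Steinhauss R H H (range (fun n => E (p n).1)) _ _ 1.
- by move=> _ [n _ <-]; split; [exact: bounded_at|exact: lE].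
- move=> x; have /cvg_seq_bounded/bounded_fun_has_ubound : cvgn (fun n => `|E (p n).1 x|).
    by apply/cvg_ex; exists `|x|; apply: cvg_norm; exact: cvgE.
  by move=> [M hM]; exists M => _ [n _ <-]; apply: hM; exists n.
have [n Mn] : exists n, M < n.+1%:R by exists (Num.truncn M); exact: truncnS_gt.
have [_ hn] := hp n.
have pn0 : 0 < `|(p n).2|.
  rewrite normr_gt0; apply/eqP => p20; move: hn.
  by rewrite p20 semigroup_linear0// normr0 mulr0 ltxx.
have := hM (E (p n).1) (ex_intro2 _ _ n Logic.I erefl) (`|(p n).2|^-1 *: (p n).2).
rewrite normrZ gtr0_norm ?invr_gt0// mulVf ?gt_eqF// lexx => /(_ isT).
rewrite semigroup_linearZ// normrZ gtr0_norm ?invr_gt0// ler_pdivrMl// => h.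
have := lt_le_trans hn h; rewrite [ltRHS]mulrC ltr_pM2r// => h2.
by have := lt_trans Mn h2; rewrite ltxx.
Qed.

(** The bound [M] on [[0, k]] gives [M ^+ n] on [[0, k * n]] by the semigroup law. *)
Lemma semigroup_bounded (T : R) : exists2 M : R, 1 <= M &
  forall t, 0 <= t <= T -> forall x, `|E t x| <= M * `|x|.
Proof.
have [k [M [k0 M1 hM]]] := bounded_near0.
have key n : forall t, 0 <= t <= k * n%:R -> forall x, `|E t x| <= M ^+ n * `|x|.
  elim: n => [|n IH] t /andP[t0 tn] x.
    have -> : t = 0 by apply/eqP; rewrite eq_le t0 andbT (le_trans tn)// mulr0.
    by rewrite semigroup0 expr0 mul1r.
  have [tk|kt] := leP t k.
    apply: le_trans (hM _ _ x) _; first by rewrite t0.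
    by rewrite ler_wpM2r// exprS ler_peMr ?exprn_ege1// (le_trans ler01).
  rewrite -(subrKC k t) semigroupD ?subr_ge0 ?(ltW k0) ?(ltW kt)// exprS -mulrA.
  apply: le_trans (hM _ _ _) _; first by rewrite (ltW k0) lexx.
  rewrite ler_wpM2l ?(le_trans ler01)//; apply: IH.
  by apply/andP; split; move: tn; rewrite -natr1; lra.
exists (M ^+ (Num.truncn (T / k)).+1) => [|t /andP[t0 tT] x]; first exact: exprn_ege1.
apply: key; rewrite t0 (le_trans tT)// -ler_pdivrMl// mulrC ltW//; exact: truncnS_gt.
Qed.

(** For a <= b, E b x - E a x = E a (E (b - a) x - x): right continuity at 0 and the local bound on
    [E] give continuity from both sides. Negative times, where [E] has no meaning, are sent to 0. *)
Lemma semigroup_orbit_continuous x : continuous (fun t => E (Num.max t 0) x).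
Proof.
apply/(continuous_distP (V := R)) => t e e0.
have [M M1 hM] := semigroup_bounded (`|t| + 1).
have M0 : 0 < M by exact: lt_le_trans M1.
have [k k0 hk] : exists2 k, 0 < k & forall h, 0 <= h < k -> `|E h x - x| < e / M.
  have [_ _ _ /(_ x)/cvgrPdist_lt/(_ (e / M) (divr_gt0 e0 M0))[k /= k0 hk]] := C0E.
  exists k => // h /andP[]; rewrite le_eqVlt => /predU1P[<-|h0] hk'.
    by rewrite semigroup0 subrr normr0 divr_gt0.
  by rewrite distrC; apply: hk => //=; rewrite sub0r normrN gtr0_norm.
have key a b : 0 <= a -> a <= b -> b - a < k -> a <= `|t| + 1 -> `|E b x - E a x| < e.
  move=> a0 ab bak aT; rewrite -(subrKC a b) semigroupD ?subr_ge0//.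
  rewrite -semigroup_linearB//; apply: le_lt_trans (hM _ _ _) _; first by rewrite a0.
  by rewrite -ltr_pdivlMl// mulrC; apply: hk; rewrite subr_ge0 ab.
exists (Num.min k 1); first by rewrite lt_min k0 ltr01.
move=> s; rewrite lt_min => /andP[sk s1].
have max_lip := ler_dist_max 0 s t.
have bT : forall a, `|a - t| < 1 -> Num.max a 0 <= `|t| + 1.
  move=> a; rewrite ltr_distl ge_max addr_ge0// andbT => /andP[_ /ltW /le_trans]; apply.
  by rewrite lerD2r ler_norm.
have m0 (a : R) : 0 <= Num.max a 0 by rewrite le_max lexx orbT.
have [st|ts] := leP (Num.max s 0) (Num.max t 0).
  rewrite distrC; apply: key => //; last exact: bT.
  by apply: le_lt_trans (ler_norm _) _; rewrite distrC (le_lt_trans max_lip).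
apply: key => //; first exact: ltW.
  by apply: le_lt_trans (ler_norm _) _; rewrite (le_lt_trans max_lip).
by apply: bT; rewrite subrr normr0.
Qed.

Lemma semigroup_continuous (tau : R -> R) f : continuous tau -> continuous f ->
  continuous (fun s => E (Num.max (tau s) 0) (f s)).
Proof.
move=> ct cf; apply/(continuous_distP (V := R)) => a e e0.
have [M M1 hM] := semigroup_bounded (`|tau a| + 1).
have M0 : 0 < M by exact: lt_le_trans M1.
have e20 : 0 < e / 2 by rewrite divr_gt0.
have [k1 k10 h1] := (continuous_distP (V := R) _).1 ct a 1 ltr01.
have [k2 k20 h2] := (continuous_distP (V := R) _).1 cf a (e / 2 / M) (divr_gt0 e20 M0).
have co : continuous (fun s => E (Num.max (tau s) 0) (f a)).
  move=> s; apply: (@continuous_comp R R H tau (fun t => E (Num.max t 0) (f a)) s).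
    exact: ct.
  exact: semigroup_orbit_continuous.
have [k3 k30 h3] := (continuous_distP (V := R) _).1 co a (e / 2) e20.
exists (Num.min k1 (Num.min k2 k3)); first by rewrite !lt_min k10 k20.
move=> s; rewrite !lt_min => /and3P[s1 s2 s3].
apply: le_lt_trans (ler_norm_dist_triangle (E (Num.max (tau s) 0) (f a)) _ _) _.
rewrite [ltRHS]splitr; apply: ler_ltD; last exact: h3.
have m0 : 0 <= Num.max (tau s) 0 by rewrite le_max lexx orbT.
rewrite -semigroup_linearB//; apply: le_trans (hM _ _ _) _.
  rewrite m0 ge_max addr_ge0// andbT.
  have := h1 s s1; rewrite ltr_distl => /andP[_ /ltW /le_trans]; apply.
  by rewrite lerD2r ler_norm.
by rewrite -ler_pdivlMl// mulrC ltW// h2.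
Qed.

(* The oscillation of an approximate orbit near [t] is read off a base point slightly before [t]. *)
Lemma approximate_orbit_osc (w : R -> H) (C : R) (D : R -> Prop) :
  0 <= C ->
  (forall s t, 0 <= s -> s <= t -> D t -> `|w t - E (t - s) (w s)| <= C * (t - s)) ->
  forall t e, 0 <= t -> 0 < e -> exists2 k, 0 < k & forall s s', 0 <= s -> 0 <= s' ->
    D s -> D s' -> `|s - t| < k -> `|s' - t| < k -> `|w s - w s'| < e.
Proof.
move=> C0 hw t e t0 e0.
have C1 : 0 < C + 1 by rewrite ltr_wpDl.
(* The base point [a] precedes [t] by at most [rho], so [s - a <= 2 * rho] and the orbit error is at
   most e/4. Continuity of the orbit of [w a] costs another e/4. *)
pose rho := e / 8 / (C + 1).
have rho0 : 0 < rho by rewrite !divr_gt0.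
pose a := Num.max 0 (t - rho).
have a0 : 0 <= a by rewrite le_max lexx.
have at_ : a <= t by rewrite ge_max t0/= gerBl ltW.
have [k k0 hk] := (continuous_distP (V := R) _).1 (@semigroup_orbit_continuous (w a)) (t - a) (e / 4)
  (divr_gt0 e0 (ltr0n _ 4)).
exists (Num.min k rho); first by rewrite lt_min k0.
have close s : 0 <= s -> D s -> `|s - t| < Num.min k rho -> `|w s - E (t - a) (w a)| < e / 2.
  move=> s0 Ds; rewrite lt_min => /andP[sk srho].
  have as_ : a <= s.
    by rewrite ge_max s0/=; move: srho; rewrite ltr_distl => /andP[/ltW].
  apply: le_lt_trans (ler_norm_dist_triangle (E (s - a) (w a)) _ _) _.
  have -> : e / 2 = e / 4 + e / 4 by lra.
  apply: ler_ltD.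
    apply: le_trans (hw _ _ a0 as_ Ds) _.
    apply: le_trans (_ : _ <= C * (2 * rho)) _.
      apply: ler_wpM2l => //; rewrite lerBlDr.
      have : t - rho <= a by rewrite le_max lexx orbT.
      by move: srho; rewrite ltr_distl => /andP[]; lra.
    apply: le_trans (_ : _ <= (C + 1) * (2 * rho)) _.
      by apply: ler_wpM2r; [rewrite mulr_ge0// ltW|rewrite lerDl].
    by rewrite /rho; have -> : (C + 1) * (2 * (e / 8 / (C + 1))) = e / 4
      by field; rewrite gt_eqF.
  have := hk (s - a); rewrite !max_l ?subr_ge0//; apply.
  by rewrite opprB addrA subrK.
move=> s s' s0 s'0 Ds Ds' st s't.
apply: le_lt_trans (ler_norm_dist_triangle (E (t - a) (w a)) _ _) _.
by rewrite [ltRHS]splitr ltrD// ?close// distrC close.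
Qed.

Definition is_convolution f t I := is_RInt (fun s => E (t - s) (f s)) 0 t I.

Lemma is_convolution_ext f g t I : (forall s, 0 <= s <= t -> f s = g s) ->
  is_convolution f t I -> is_convolution g t I.
Proof. by move=> fg; apply: is_RInt_ext => s st; rewrite fg. Qed.

Lemma is_convolution_unique f t I J : 0 <= t ->
  is_convolution f t I -> is_convolution f t J -> I = J.
Proof. exact: is_RInt_unique. Qed.

Lemma is_convolution_exists f t : continuous f -> 0 <= t -> exists I, is_convolution f t I.
Proof.
move=> cf t0.
(* The maximum with 0 makes the integrand continuous on [R] and changes nothing on [[0, t]]. *)
have [|I hI] := @is_RInt_exists R H (fun s => E (Num.max (t - s) 0) (f s)) 0 t _ t0.
  by apply: semigroup_continuous => // s; apply: cvgB; [exact: cvg_cst|exact: cvg_id].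
by exists I; apply: is_RInt_ext hI => s /andP[_ st]; rewrite max_l// subr_ge0.
Qed.

Lemma is_convolutionB f g t I J : is_convolution f t I -> is_convolution g t J ->
  is_convolution (fun s => f s - g s) t (I - J).
Proof.
move=> fI gJ; apply: is_RInt_ext (is_RIntB fI gJ) => s /andP[_ st].
by rewrite semigroup_linearB// subr_ge0.
Qed.

Lemma is_convolution_norm f t I M C : 0 <= t -> 0 <= M ->
  (forall s, 0 <= s <= t -> forall x, `|E s x| <= M * `|x|) ->
  (forall s, 0 <= s <= t -> `|f s| <= C) ->
  is_convolution f t I -> `|I| <= M * C * t.
Proof.
move=> t0 M0 EM fC /is_RInt_norm; rewrite -[X in M * C * X]subr0; apply => // s /andP[s0 st].
apply: le_trans (EM _ _ _) _; first by rewrite subr_ge0 st gerBl.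
by rewrite ler_wpM2l// fC// s0.
Qed.

(** The integral is split at [s]. On [[0, s]] the operator [E t] factors out of the integrand and,
    being linear and bounded, out of the integral; the rest is a translate. This identity underlies
    restarting and gluing of solutions. *)
Lemma is_convolutionD f s t I J K : continuous f -> 0 <= s -> 0 <= t ->
  is_convolution f s I -> is_convolution (fun q => f (q + s)) t J ->
  is_convolution f (s + t) K -> K = E t I + J.
Proof.
move=> cf s0 t0 fI fJ fK.
have st0 : s <= s + t by rewrite lerDl.
apply: (is_RInt_split s0 st0 _ _ fK).
  have [M _ hM] := semigroup_bounded t.
  apply: is_RInt_ext (is_RInt_linear (lE t0) (hM t _) fI); last by rewrite t0 lexx.
  by move=> q /andP[_ qs]; rewrite -semigroupD ?subr_ge0// addrA [t + s]addrC.
have h : is_RInt (fun q => E (t - q) (f (q + s))) (s - s) (s + t - s) J.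
  by rewrite subrr addrAC subrr add0r.
apply: is_RInt_ext (is_RInt_shift h) => q _.
by rewrite subrK opprB addrA [t + s]addrC.
Qed.

Definition convolution f t : H := xget 0 (is_convolution f t).

Lemma convolutionP f t : continuous f -> 0 <= t -> is_convolution f t (convolution f t).
Proof.
move=> cf t0; apply: (@xgetPex _ 0 (is_convolution f t)); exact: is_convolution_exists.
Qed.

(** The convolution is an approximate orbit: beyond E (t - s) applied to its value at s, only an
    integral over a length t - s remains, of norm at most M C (t - s). *)
Lemma convolution_continuous f : continuous f ->
  continuous (fun t => convolution f (Num.max t 0)).
Proof.
move=> cf; apply/(continuous_distP (V := R)) => t e e0.
have [M M1 hM] := semigroup_bounded (`|t| + 1).
have [C C0 hC] := continuous_segment_bounded 0 (`|t| + 1) cf.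
have M0 : 0 <= M by exact: le_trans M1.
have [|s t1 s0 st tT||k k0 hk] := @approximate_orbit_osc (convolution f) (M * C)
    (fun s => s <= `|t| + 1) _ _ (Num.max t 0) e _ e0.
- exact: mulr_ge0.
- have := convolutionP cf (le_trans s0 st); rewrite -{1}(subrKC s t1) => h.
  have cf' : continuous (fun q => f (q + s)).
    move=> q; apply: (@continuous_comp R R H (fun q => q + s) f q).
      by apply: cvgD; [exact: cvg_id|exact: cvg_cst].
    exact: cf.
  have ts0 : 0 <= t1 - s by rewrite subr_ge0.
  have hJ := convolutionP cf' ts0.
  rewrite (is_convolutionD cf s0 ts0 (convolutionP cf s0) hJ h) addrC addKr.
  apply: is_convolution_norm hJ => // q /andP[q0 qt].
    by apply: hM; rewrite q0 (le_trans qt)// (le_trans _ tT)// gerBl.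
  by apply: hC; rewrite addr_ge0//= -lerBrDr (le_trans qt)// lerB.
- by rewrite le_max lexx orbT.
exists (Num.min k 1); first by rewrite lt_min k0 ltr01.
move=> s; rewrite lt_min => /andP[sk s1].
have m0 (a : R) : 0 <= Num.max a 0 by rewrite le_max lexx orbT.
have bT (a : R) : `|a - t| < 1 -> Num.max a 0 <= `|t| + 1.
  rewrite ltr_distl ge_max addr_ge0// andbT => /andP[_ /ltW /le_trans]; apply.
  by rewrite lerD2r ler_norm.
apply: hk => //; [exact: bT|by apply: bT; rewrite subrr normr0| |].
- exact: le_lt_trans (ler_dist_max _ _ _) sk.
- by rewrite subrr normr0.
Qed.

End semigroup.

(** * Histories and solutions *)

Section clamp.
Context {R : realType}.
Implicit Types (a b s t : R).

Definition clamp a b t := Num.max a (Num.min t b).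

Lemma clamp_itv a b t : a <= b -> a <= clamp a b t <= b.
Proof. by move=> ab; rewrite /clamp le_max lexx/= ge_max ab ge_min lexx orbT. Qed.

Lemma clamp_id a b t : a <= t <= b -> clamp a b t = t.
Proof. by move=> /andP[at_ tb]; rewrite /clamp (min_l tb) (max_r at_). Qed.

Lemma clamp_dist a b s t : `|clamp a b s - clamp a b t| <= `|s - t|.
Proof.
rewrite /clamp ![Num.max a _]maxC.
exact: le_trans (ler_dist_max _ _ _) (ler_dist_min _ _ _).
Qed.

Lemma clamp_continuous a b : continuous (clamp a b).
Proof.
apply/(continuous_distP (V := R) (W := R)) => x e e0; exists e => // y.
exact: le_lt_trans (clamp_dist _ _ _ _).
Qed.

(** Trades continuity within a segment for continuity on [R], with the same values on the
    segment. *)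
Lemma within_clamp_continuous (W : normedModType R) (u : R -> W) a b : a <= b ->
  {within `[a, b], continuous u} -> continuous (fun t => u (clamp a b t)).
Proof.
move=> ab /subspace_continuousP cu; apply/(continuous_distP (V := R)) => x e e0.
have xab : `[a, b]%classic (clamp a b x) by rewrite /= in_itv/= clamp_itv.
have /cvgrPdist_lt/(_ e e0) := cu _ xab.
rewrite near_withinE near_nbhs => /nbhs_ballP[k /= k0 h]; exists k => // y yx.
rewrite distrC; apply: h; last by rewrite in_itv/= clamp_itv.
by rewrite /ball/= distrC (le_lt_trans (clamp_dist _ _ _ _)).
Qed.

Lemma continuous_comp_real (W : normedModType R) (f : R -> W) (g : R -> R) :
  continuous g -> continuous f -> continuous (fun t => f (g t)).
Proof. by move=> cg cf t; apply: (@continuous_comp R R W g f t); [exact: cg|exact: cf]. Qed.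

Lemma continuous_shift (W : normedModType R) (f : R -> W) (c : R) :
  continuous f -> continuous (fun t => f (t + c)).
Proof.
by move=> cf; apply: continuous_comp_real => // t; apply: cvgD; [exact: cvg_id|exact: cvg_cst].
Qed.

End clamp.

Section history_segments.
Context {R : realType} {H : normedModType R} {r : R}.
Hypothesis r_ge0 : 0 <= r.
Implicit Types (phi psi : history H r) (u v : R -> H).

Lemma history_sub_le phi psi s : `|phi s - psi s| <= `|phi - psi|.
Proof. exact: (history_le_norm (phi - psi) s). Qed.

Lemma history_dist_le phi psi e : 0 <= e ->
  (forall s, - r <= s <= 0 -> `|phi s - psi s| <= e) -> `|phi - psi| <= e.
Proof.
by move=> e0 h; exact: (@history_norm_le R H r (phi - psi) e e0 h).
Qed.

Lemma history_ext phi psi : (forall s, - r <= s <= 0 -> phi s = psi s) -> phi = psi.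
Proof.
move=> h; apply/eqP; rewrite -subr_eq0 -normr_le0; apply: history_dist_le => // s sr.
by rewrite h// subrr normr0.
Qed.

Lemma history_atC u t s : continuous u -> - r <= s <= 0 -> history_at r u t s = u (t + s).
Proof. by move=> cu sr; apply: history_atE; [exact: continuous_subspaceT|rewrite in_itv]. Qed.

Lemma eq_history_at u v t t' : (forall s, - r <= s <= 0 -> u (t + s) = v (t' + s)) ->
  history_at r u t = history_at r v t'.
Proof.
move=> uv; rewrite /history_at; congr insubd; apply/funext => s.
by case: ifPn => //; rewrite in_itv => /uv.
Qed.

Lemma history_at_dist u v t t' e : continuous u -> continuous v -> 0 <= e ->
  (forall s, - r <= s <= 0 -> `|u (t + s) - v (t' + s)| <= e) ->
  `|history_at r u t - history_at r v t'| <= e.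
Proof.
move=> cu cv e0 h; apply: history_dist_le => // s sr.
by rewrite !history_atC//; exact: h.
Qed.

Lemma history_at_continuous u : continuous u -> continuous (history_at r u).
Proof.
move=> cu; apply/(continuous_distP (V := R)) => t e e0.
have e20 : 0 < e / 2 by rewrite divr_gt0.
have [k k0 h] := uniform_continuous_segment (t - r) t cu e20.
exists k => // t' t't; apply: le_lt_trans (_ : _ <= e / 2) _; last first.
  by rewrite ltr_pdivrMr// ltr_pMr// ltr1n.
apply: history_at_dist => // [|s sr]; first exact: ltW.
apply: h; first by move: sr; lra.
by rewrite opprD addrACA subrr addr0 ltW.
Qed.

Lemma history_clamp_continuous phi : continuous (fun t => phi (clamp (- r) 0 t)).
Proof.
apply: within_clamp_continuous; first by rewrite oppr_le0.
by have [] := historyP phi.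
Qed.

Lemma history_at0 u phi : continuous u ->
  history_at r u 0 = phi <-> forall s, - r <= s <= 0 -> u s = phi s.
Proof.
move=> cu; split=> [<- s sr|h]; first by rewrite history_atC// add0r.
by apply: history_ext => s sr; rewrite history_atC// add0r h.
Qed.

Lemma history_at_clamp phi : history_at r (fun t => phi (clamp (- r) 0 t)) 0 = phi.
Proof.
apply/history_at0 => [|s sr]; first exact: history_clamp_continuous.
by rewrite clamp_id.
Qed.

(** Keeps the segments of [u] in the ball where the local estimate holds. At times before 0 the loss
    is rho/4 from the initial distance and rho/4 from translating [phi]; at later times it is rho/2
    + rho/4 through the value [phi 0]. *)
Lemma history_at_near phi rho : 0 < rho -> exists2 k : R, 0 < k &
  forall u, continuous u -> forall T, 0 <= T <= k -> `|history_at r u 0 - phi| <= rho / 4 ->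
  (forall t, 0 <= t <= T -> `|u t - phi 0| <= rho / 2) ->
  forall s, 0 <= s <= T -> `|history_at r u s - phi| <= rho.
Proof.
move=> rho0; have rho40 : 0 < rho / 4 by rewrite divr_gt0.
have [k k0 h] := uniform_continuous_segment (- r) 0 (@history_clamp_continuous phi) rho40.
have {}h s t : - r <= s <= 0 -> - r <= t <= 0 -> `|t - s| <= k -> `|phi t - phi s| <= rho / 4.
  by move=> sr tr /(h _ sr); rewrite !clamp_id.
exists k => // u cu T /andP[T0 Tk] u0 uT s /andP[s0 sT].
apply: history_dist_le => [|q qr]; first exact: ltW.
rewrite history_atC//; have /andP[q1 q2] := qr; have [sq|sq] := leP (s + q) 0.
  have sqr : - r <= s + q <= 0 by rewrite sq andbT; lra.
  apply: le_trans (ler_norm_dist_triangle (phi (s + q)) _ _) _.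
  have h1 : `|u (s + q) - phi (s + q)| <= rho / 4.
    have -> : u (s + q) = history_at r u 0 (s + q) by rewrite history_atC// add0r.
    exact: le_trans (history_sub_le _ _ _) u0.
  have h2 : `|phi (s + q) - phi q| <= rho / 4.
    by apply: h => //; rewrite addrK ger0_norm// (le_trans sT).
  by lra.
apply: le_trans (ler_norm_dist_triangle (phi 0) _ _) _.
have h1 : `|u (s + q) - phi 0| <= rho / 2 by apply: uT; lra.
have h2 : `|phi 0 - phi q| <= rho / 4.
  by apply: h => //; [rewrite lexx oppr_le0 r_ge0|rewrite sub0r ger0_norm; lra].
by lra.
Qed.

End history_segments.

(** * The delay term, the forcing term and restarting of solutions *)

Section solutions.
Context {R : realType} {H : completeNormedModType R}.
Variables (r d : R) (E : R -> H -> H) (B : H -> H) (eta : history H r -> R) (LB : R).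
Hypotheses (r_gt0 : 0 < r) (C0E : C0_semigroup E) (LB_ge0 : 0 <= LB).
Hypothesis B_lip : forall x y, `|B x - B y| <= LB * `|x - y|.
Hypothesis eta_bounds : forall phi, 0 <= eta phi /\ eta phi <= r.
Hypothesis eta_cont : continuous eta.
Implicit Types (phi psi : history H r) (u v : R -> H).

Let r_ge0 : 0 <= r. Proof. exact: ltW. Qed.

Local Notation F := (delay_term B eta).

Lemma delay_itv phi : - r <= - eta phi <= 0.
Proof. by have [h1 h2] := eta_bounds phi; rewrite lerN2 h2 oppr_le0. Qed.

(** Replacing [psi] by [phi] at the delay of [psi] costs |psi - phi|; moving the delay is then
    controlled by continuity of [eta] and uniform continuity of [phi]. *)
Lemma delay_term_continuous : continuous F.
Proof.
suff key phi (e : R) : 0 < e -> exists2 k : R, 0 < k &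
    forall psi, `|psi - phi| < k -> `|F psi - F phi| < e by exact/continuous_distP.
move=> e0.
have L1 : 0 < LB + 1 by rewrite ltr_wpDl.
have e'0 : 0 < e / 2 / (LB + 1) by rewrite !divr_gt0.
have [k k0 h] := uniform_continuous_segment (- r) 0 (@history_clamp_continuous _ _ _ r_ge0 phi) e'0.
have [k' k'0 h'] := (continuous_distP (W := R) _).1 eta_cont phi k k0.
exists (Num.min k' (e / 2 / (LB + 1))); first by rewrite lt_min k'0.
move=> psi; rewrite lt_min => /andP[pk pe].
apply: le_lt_trans (B_lip _ _) _.
apply: (@le_lt_trans _ _ ((LB + 1) * `|psi (- eta psi) - phi (- eta phi)|)).
  by rewrite ler_wpM2r// lerDl.
rewrite -ltr_pdivlMl// mulrC.
apply: le_lt_trans (ler_norm_dist_triangle (phi (- eta psi)) _ _) _.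
rewrite [e in ltRHS]splitr mulrDl.
apply: ltr_leD; first exact: le_lt_trans (history_sub_le _ _ _) pe.
have := h _ (delay_itv phi) (- eta psi); rewrite !clamp_id ?delay_itv//; apply.
by rewrite -opprD normrN ltW//; exact: h'.
Qed.

(** Linear growth, uniform in the delay: the source of the a priori bound on solutions. *)
Lemma delay_term_bound phi : `|F phi| <= `|B 0| + LB * `|phi|.
Proof.
rewrite -[F phi](subrKC (B 0)); apply: le_trans (ler_normD _ _) _; rewrite lerD2l.
apply: le_trans (B_lip _ _) _; rewrite ler_wpM2l// subr0; exact: history_le_norm.
Qed.

Definition forcing u s : H := F (history_at r u s) - d *: u s.

Lemma forcing_continuous u : continuous u -> continuous (forcing u).
Proof.
move=> cu t; apply: cvgB; last by apply: cvgZr; exact: cu.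
apply: (@continuous_comp R (history H r) H (history_at r u) F t).
  exact: history_at_continuous.
exact: delay_term_continuous.
Qed.

Lemma eq_forcing u v s s' : (forall q, - r <= q <= 0 -> u (s + q) = v (s' + q)) ->
  forcing u s = forcing v s'.
Proof.
move=> uv; rewrite /forcing (eq_history_at uv).
by rewrite -[s]addr0 uv ?addr0// lexx oppr_le0 r_ge0.
Qed.

Lemma forcing_bound u s C : continuous u -> 0 <= C ->
  (forall q, s - r <= q <= s -> `|u q| <= C) -> `|forcing u s| <= `|B 0| + (LB + `|d|) * C.
Proof.
move=> cu C0 uC; apply: le_trans (ler_normB _ _) _; rewrite mulrDl addrA lerD//.
  apply: le_trans (delay_term_bound _) _; rewrite lerD2l ler_wpM2l//.
  rewrite -[history_at _ _ _]subr0; apply: history_dist_le => // q qr.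
  by rewrite history_atC// subr0 uC//; move: qr; lra.
by rewrite normrZ ler_wpM2l// uC// lexx gerBl r_ge0.
Qed.

(* Mild solutions carried by a curve continuous on all of [R], so that histories and
   the forcing term make sense at every time; only the values on [- r, T] matter. *)
Definition sol phi T u := [/\ continuous u, history_at r u 0 = phi &
  forall t, 0 <= t <= T -> is_convolution E (forcing u) t (u t - E t (phi 0))].

Lemma sol_le phi T T' u : T' <= T -> sol phi T u -> sol phi T' u.
Proof.
by move=> TT [cu u0 h]; split=> // t /andP[t0 tT]; apply: h; rewrite t0 (le_trans tT).
Qed.

Lemma sol_init phi T u s : sol phi T u -> - r <= s <= 0 -> u s = phi s.
Proof. by case=> cu /(history_at0 _ cu) h _ /h. Qed.

Lemma sol_init0 phi T u : sol phi T u -> u 0 = phi 0.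
Proof. by move=> /sol_init; apply; rewrite lexx oppr_le0 r_ge0. Qed.

Lemma sol_ext phi T u v : 0 <= T -> continuous v -> (forall t, - r <= t <= T -> u t = v t) ->
  sol phi T u -> sol phi T v.
Proof.
move=> T0 cv uv [cu u0 h]; split=> //.
  rewrite -u0; apply: eq_history_at => s; rewrite !add0r => /andP[s1 s2].
  by rewrite uv// s1 (le_trans s2).
move=> t /andP[t0 tT]; rewrite -uv ?tT ?andbT ?(le_trans _ t0) ?oppr_le0//.
apply: is_convolution_ext (h t _); last by rewrite t0.
move=> s /andP[s0 st]; apply: eq_forcing => q qr; apply: uv.
by move: qr; lra.
Qed.

(** The forcing term depends on time only through the segment, so its translate is the forcing of
    the translate. Splitting the convolution at [s] and cancelling [E t] of the equation at [s]
    leaves the equation started at [s]. *)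
Lemma sol_shift phi T u s : 0 <= s <= T -> sol phi T u ->
  sol (history_at r u s) (T - s) (fun t => u (t + s)).
Proof.
move=> /andP[s0 sT] [cu u0 h]; split=> [||t /andP[t0 tT]].
- exact: continuous_shift.
- by apply: eq_history_at => q qr; rewrite add0r addrC.
have cf := forcing_continuous cu.
have [J hJ] := is_convolution_exists C0E (continuous_shift (c := s) cf) t0.
have ts : 0 <= s + t <= T by rewrite addr_ge0//= addrC -lerBrDr.
have hs : 0 <= s <= T by rewrite s0.
have e := is_convolutionD C0E cf s0 t0 (h _ hs) hJ (h _ ts).
have {}hJ : is_convolution E (forcing (fun t => u (t + s))) t J.
  apply: is_convolution_ext hJ => q _; apply: eq_forcing => q' _.
  by rewrite addrAC.
suff -> : u (t + s) - E t (history_at r u s 0) = J by [].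
rewrite history_atC ?lexx ?oppr_le0 ?r_ge0// addr0.
move: e; rewrite (semigroup_linearB C0E)// -(semigroupD C0E)// [t + s]addrC => e.
by apply: (addrI (E t (u s) - E (s + t) (phi 0))); rewrite -e addrAC subrKC.
Qed.

(** After restarting at [s], the deviation from the orbit of [u s] is one convolution over a length
    [t - s]. *)
Lemma sol_step phi T u s t M C : 0 <= M ->
  (forall q, 0 <= q <= t - s -> forall x, `|E q x| <= M * `|x|) ->
  0 <= s -> s <= t -> t <= T -> sol phi T u ->
  (forall q, s <= q <= t -> `|forcing u q| <= C) ->
  `|u t - E (t - s) (u s)| <= M * C * (t - s).
Proof.
move=> M0 EM s0 st tT su fC; have cu : continuous u by case: su.
have sT : 0 <= s <= T by rewrite s0 (le_trans st).
have [_ _ /(_ (t - s))] := sol_shift sT su.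
rewrite subr_ge0 st lerB// subrK history_atC ?lexx ?oppr_le0 ?r_ge0// addr0 => /(_ isT).
apply: is_convolution_norm; rewrite ?subr_ge0// => q /andP[q0 qt].
have -> : forcing (fun t => u (t + s)) q = forcing u (q + s).
  by apply: eq_forcing => q' _; rewrite addrAC.
by apply: fC; rewrite lerDr q0 -lerBrDr.
Qed.

End solutions.

(** * Stability of the delay and the local estimate *)

Section local_theory.
Context {R : realType} {H : completeNormedModType R}.
Variables (r d : R) (E : R -> H -> H) (B : H -> H) (LB : R).
Variables (Theta_u Theta_l eta : history H r -> R).
Hypotheses (r_gt0 : 0 < r) (C0E : C0_semigroup E) (LB_ge0 : 0 <= LB).
Hypothesis B_lip : forall x y, `|B x - B y| <= LB * `|x - y|.
Hypothesis Theta_bounds : forall phi,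
  0 <= Theta_l phi /\ Theta_l phi <= Theta_u phi /\ Theta_u phi <= r.
Hypothesis eta_bounds : forall phi, 0 <= eta phi /\ eta phi <= r.
Hypothesis Theta_l_cont : continuous Theta_l.
Hypothesis eta_cont : continuous eta.
Hypothesis Z_lipschitz : exists L : R,
  forall phi, Theta_l phi = 0 -> lipschitz_history L phi.
Hypothesis eta_ignores : forall phi psi : history H r,
  (forall theta, theta \in `[- Theta_u phi, - Theta_l phi] -> psi theta = phi theta) ->
  eta psi = eta phi.
Hypothesis eta_pos_on_Z : forall phi, Theta_l phi = 0 -> 0 < eta phi.
Hypothesis eta_lipschitz_near_Z : exists omega L_eta : R,
  [/\ 0 < omega, 0 < L_eta &
    forall phi psi : history H r,
      (exists2 nu, Theta_l nu = 0 & `|phi - nu| <= omega) ->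
      (exists2 nu, Theta_l nu = 0 & `|psi - nu| <= omega) ->
      `|eta phi - eta psi| <= L_eta * `|phi - psi|].
Implicit Types (phi psi : history H r) (u v : R -> H).

Let r_ge0 : 0 <= r. Proof. exact: ltW. Qed.

Local Notation F := (delay_term B eta).
Local Notation seg := (history_at r).

Lemma delay_term_at u s : continuous u -> F (seg u s) = B (u (s - eta (seg u s))).
Proof. by move=> cu; rewrite /delay_term history_atC// delay_itv. Qed.

(* If [Theta_l phi > 0], the delay along [v] near [phi] only sees the initial history,
   so that it depends on it as the delay along [u] corrected by the initial difference. *)
Lemma delay_stable phi : 0 < Theta_l phi ->
  exists rho k, [/\ 0 < rho, 0 < k & forall T u, T <= k -> continuous u ->
    (forall s, 0 <= s <= T -> `|seg u s - phi| <= rho) ->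
    forall e, 0 < e -> exists2 g, 0 < g & forall v, continuous v ->
      (forall s, 0 <= s <= T -> `|seg v s - phi| <= rho) ->
      `|seg v 0 - seg u 0| <= g ->
      forall s, 0 <= s <= T -> `|eta (seg v s) - eta (seg u s)| <= e].
Proof.
move=> c0.
have c20 : 0 < Theta_l phi / 2 by rewrite divr_gt0.
have [rho rho0 hrho] := (continuous_distP (W := R) _).1 Theta_l_cont phi _ c20.
exists (rho / 2), (Theta_l phi / 2); split=> [||T u Tk cu uT e e0]; rewrite ?divr_gt0//.
have [g g0 hg] := @continuous_near_compact R (history H r) R (seg u) eta 0 T e
  (history_at_continuous cu) eta_cont e0.
exists g => // v cv vT vu s /andP[s0 sT].
(* [w] equals [v] before time 0 and [u] plus the constant [v 0 - u 0] afterwards. On the times read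
   by the segments it stays within |v_0 - u_0| of [u]. *)
pose w t := u t + (v (Num.min t 0) - u (Num.min t 0)).
have cmin : continuous (fun t : R => Num.min t 0).
  apply/(continuous_distP (V := R) (W := R)) => x e1 e10; exists e1 => // y.
  exact: le_lt_trans (ler_dist_min _ _ _).
have cw : continuous w.
  move=> t; apply: cvgD; first exact: cu.
  by apply: cvgB; [exact: (continuous_comp_real cmin cv)|exact: (continuous_comp_real cmin cu)].
have <- : eta (seg w s) = eta (seg v s).
  apply: eta_ignores => th; rewrite in_itv/= => /andP[th1 th2].
  have [h1 [h2 h3]] := Theta_bounds (seg v s).
  have thr : - r <= th <= 0 by apply/andP; split; lra.
  rewrite !history_atC// /w (_ : Num.min (s + th) 0 = s + th) ?subrKC//.
  apply: min_l.
  (* Hence Theta_l (seg v s) > Theta_l phi / 2 >= T >= s, so the window seen by [eta] lies at times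
     s + th <= 0, where [w] and [v] coincide. *)
  have : `|Theta_l (seg v s) - Theta_l phi| < Theta_l phi / 2.
    apply: hrho; apply: le_lt_trans (vT s _) _; first by rewrite s0.
    by rewrite ltr_pdivrMr// ltr_pMr// ltr1n.
  by rewrite ltr_distl; lra.
apply: hg; first by rewrite s0.
apply: history_at_dist => // [|q /andP[q1 q2]]; first exact: ltW.
rewrite /w addrAC subrr add0r.
have mr : - r <= Num.min (s + q) 0 <= 0.
  by rewrite le_min ge_min lexx orbT oppr_le0 r_ge0 !andbT; lra.
apply: le_trans vu; have := history_sub_le (seg v 0) (seg u 0) (Num.min (s + q) 0).
by rewrite !history_atC// !add0r.
Qed.

(** The order of quantifiers matters: [rho], [k], [K] depend on [phi] alone, [g] also on [u] and
    [e]. The bound [N] concerns only times up to [s], and the same [g] serves all [v]. *)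
Lemma local_lipschitz phi : exists rho k K, [/\ 0 < rho, 0 < k, 0 <= K &
  forall T u, T <= k -> continuous u -> seg u 0 = phi ->
    (forall s, 0 <= s <= T -> `|seg u s - phi| <= rho) ->
    forall e, 0 < e -> exists2 g, 0 < g & forall v, continuous v ->
      (forall s, 0 <= s <= T -> `|seg v s - phi| <= rho) -> `|seg v 0 - phi| <= g ->
      forall s N, 0 <= s <= T -> (forall t, - r <= t <= s -> `|u t - v t| <= N) ->
        `|F (seg u s) - F (seg v s)| <= e + K * N].
Proof.
have : 0 <= Theta_l phi by have [] := Theta_bounds phi.
rewrite le_eqVlt => /predU1P[/esym phiZ|/delay_stable[rho [k [rho0 k0 stab]]]]; last first.
  exists rho, k, LB; split=> // T u Tk cu u0 uT e e0.
  have L1 : 0 < LB + 1 by rewrite ltr_wpDl.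
  have e'0 : 0 < e / (LB + 1) by rewrite divr_gt0.
  have [k' k'0 hk'] := uniform_continuous_segment (- r) T cu e'0.
  have [g g0 hg] := stab T u Tk cu uT k' k'0.
  exists g => // v cv vT v0 s N /andP[s0 sT] uvN.
  have [a1 a2] := eta_bounds (seg u s); have [b1 b2] := eta_bounds (seg v s).
  rewrite !delay_term_at//; apply: le_trans (B_lip _ _) _.
  apply: le_trans (_ : _ <= LB * (e / (LB + 1) + N)) _.
    rewrite ler_wpM2l//.
    apply: le_trans (ler_norm_dist_triangle (u (s - eta (seg v s))) _ _) _.
    apply: lerD; last by apply: uvN; apply/andP; split; lra.
    apply: hk'; first by apply/andP; split; lra.
    rewrite opprB addrC subrKA; apply: hg => //; first by rewrite u0.
    by rewrite s0.
  rewrite mulrDr lerD2r mulrA ler_pdivrMr// mulrC ler_wpM2l ?(ltW e0)// lerDl//.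
have [L hL] := Z_lipschitz; have [omega [Leta [om0 Leta0 hLeta]]] := eta_lipschitz_near_Z.
have eta0 := eta_pos_on_Z phiZ.
have eta20 : 0 < eta phi / 2 by rewrite divr_gt0.
have [rho rho0 hrho] := (continuous_distP (W := R) _).1 eta_cont phi _ eta20.
(* In this ball [eta] is Lipschitz and at least [eta phi / 2], so that [s - eta <= 0] as long as
   [s <= eta phi / 2]. In [K], [L] and [Leta] convert a difference of delays into one of values of
   [phi], and 1 stands for [u - v] at a common time. *)
exists (Num.min omega (rho / 2)), (eta phi / 2), (LB * (`|L| * Leta + 1)).
split=> //; [by rewrite lt_min om0 divr_gt0|
  by rewrite mulr_ge0// addr_ge0// mulr_ge0// ltW|].
move=> T u Tk cu u0 uT e e0; exists 1 => // v cv vT _ s N /andP[s0 sT] uvN.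
have sT' : 0 <= s <= T by rewrite s0.
have eta_ge chi : `|chi - phi| <= Num.min omega (rho / 2) -> eta phi / 2 <= eta chi.
  rewrite le_min => /andP[_ h]; have : `|eta chi - eta phi| < eta phi / 2.
    by apply: hrho; apply: le_lt_trans h _; rewrite ltr_pdivrMr// ltr_pMr// ltr1n.
  by rewrite ltr_distl; lra.
have near_Z chi : `|chi - phi| <= Num.min omega (rho / 2) ->
    exists2 nu, Theta_l nu = 0 & `|chi - nu| <= omega.
  by rewrite le_min => /andP[h _]; exists phi.
have [a1 a2] := eta_bounds (seg u s); have [b1 b2] := eta_bounds (seg v s).
have a3 := eta_ge _ (uT _ sT'); have b3 := eta_ge _ (vT _ sT').
have N0 : 0 <= N by apply: le_trans (normr_ge0 _) (uvN s _); rewrite lexx andbT (le_trans _ s0)// oppr_le0.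
have uphi t : - r <= t <= 0 -> u t = phi t by exact: (history_at0 phi cu).1.
have phi_lip t t' : - r <= t <= 0 -> - r <= t' <= 0 -> `|phi t - phi t'| <= `|L| * `|t - t'|.
  move=> tr t'r; have [->|tt'] := eqVneq t t'; first by rewrite !subrr !normr0 mulr0.
  rewrite -ler_pdivrMr ?normr_gt0 ?subr_eq0//.
  by apply: le_trans (hL _ phiZ _ _ _ _ tt') (ler_norm _); rewrite in_itv.
rewrite !delay_term_at//; apply: le_trans (B_lip _ _) _.
apply: le_trans (_ : _ <= LB * (`|L| * Leta + 1) * N) _; last by rewrite lerDr ltW.
rewrite -mulrA ler_wpM2l//.
apply: le_trans (ler_norm_dist_triangle (u (s - eta (seg v s))) _ _) _.
rewrite mulrDl mul1r; apply: lerD; last first.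
  by apply: uvN; rewrite gerBl b1 andbT lerBrDr addrC (le_trans _ s0)// subr_le0.
have delayed_itv chi : eta chi <= r -> eta phi / 2 <= eta chi -> - r <= s - eta chi <= 0.
  move=> ler hle; rewrite subr_le0 (le_trans sT (le_trans Tk hle)) andbT.
  by rewrite lerBrDr addrC (le_trans _ s0)// subr_le0.
rewrite !uphi ?delayed_itv//; apply: le_trans (phi_lip _ _ _ _) _; rewrite ?delayed_itv//.
rewrite -mulrA ler_wpM2l// opprB addrC subrKA distrC.
apply: le_trans (hLeta _ _ (near_Z _ (uT _ sT')) (near_Z _ (vT _ sT'))) _.
rewrite ler_wpM2l ?(ltW Leta0)//; apply: history_at_dist => // q qr.
by apply: uvN; move: qr; lra.
Qed.


(** * A priori bounds and continuous dependence on the initial history *)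

Local Notation sol := (sol d E B eta).
Local Notation forcing := (forcing d B eta).

(** Time advances in steps of length [h] with M D h <= 1/2. In one step the maximum of |v| is at
    most M C + M |B 0| plus half of itself, which gives the next bound [C']; the number of steps
    depends on [T] only. *)
Lemma sol_bounded (T A : R) : exists2 C : R, 0 <= C & forall (T' : R) psi v, T' <= T -> `|psi| <= A ->
  sol psi T' v -> forall t, - r <= t <= T' -> `|v t| <= C.
Proof.
have [M M1 hM] := semigroup_bounded C0E 1.
have M0 : 0 <= M by exact: le_trans M1.
pose D := LB + `|d|; have D0 : 0 <= D by rewrite addr_ge0.
have MD1 : 0 < 2 * (M * D + 1) by rewrite mulr_gt0// ltr_wpDl// mulr_ge0.
pose h := (2 * (M * D + 1))^-1.
have h0 : 0 < h by rewrite invr_gt0.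
have h1 : h <= 1.
  rewrite invf_le1//; have : 0 <= M * D by rewrite mulr_ge0.
  lra.
have MDh : M * D * h <= 1 / 2.
  rewrite /h ler_pdivrMr//; have : 0 <= M * D by rewrite mulr_ge0.
  lra.
have fbD v p N : continuous v -> 0 <= N -> (forall q, p - r <= q <= p -> `|v q| <= N) ->
    `|forcing v p| <= `|B 0| + D * N.
  by move=> cv; exact: forcing_bound.
clearbody h D.
suff key (n : nat) : exists2 C : R, 0 <= C & forall (T' : R) psi v, `|psi| <= A ->
    sol psi T' v -> forall t, - r <= t <= T' -> t <= h * n%:R -> `|v t| <= C.
  have [C C0 hC] := key (Num.truncn (T / h)).+1; exists C => // T' psi v TT pA sv t tr.
  apply: (hC _ _ _ pA sv) => //; rewrite mulrC -ler_pdivrMr// ltW//.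
  apply: le_lt_trans (truncnS_gt _); rewrite ler_pM2r ?invr_gt0//.
  by case/andP: tr => _ /le_trans; apply.
elim: n => [|n [C C0 IH]].
  exists `|A| => // T' psi v pA sv t /andP[t1 _]; rewrite mulr0 => t2.
  rewrite (sol_init sv) ?t1//; apply: le_trans (history_le_norm _ _) _.
  exact: le_trans (ler_norm _).
pose C' := 2 * M * C + 2 * M * `|B 0|.
have C'0 : 0 <= C' by rewrite addr_ge0// !mulr_ge0.
exists (C + C') => [|T' psi v pA sv t /andP[t1 t2] t3]; first exact: addr_ge0.
have [tn|nt] := leP t (h * n%:R).
  by apply: le_trans (IH _ _ _ pA sv t _ tn) _; rewrite ?t1// lerDl.
have cv : continuous v by case: sv.
have tau0 : 0 <= h * n%:R by rewrite mulr_ge0// ltW.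
(* The maximum is taken over all of [[- r, t]], since the forcing reads the past: [q] lies either in
   an earlier step, already bounded, or in the current one. *)
have [|q /andP[q1 q2] qmax] := @norm_max R H v (- r) t _ cv; first by lra.
apply: le_trans (qmax t _) _; first by rewrite t1 lexx.
have [qn|nq] := leP q (h * n%:R).
  apply: le_trans (IH _ _ _ pA sv q _ qn) _; last by rewrite lerDl.
  by rewrite q1 (le_trans q2).
have nS : h * n.+1%:R = h * n%:R + h by rewrite -natr1 mulrDr mulr1.
have qh : q - h * n%:R <= h by lra.
have fb p : h * n%:R <= p <= q -> `|forcing v p| <= `|B 0| + D * `|v q|.
  by move=> pq; apply: fbD => // p' p'r; apply: qmax; lra.
have step : `|v q - E (q - h * n%:R) (v (h * n%:R))| <= M * (`|B 0| + D * `|v q|) * (q - h * n%:R).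
  apply: (sol_step r_gt0 C0E LB_ge0 B_lip eta_bounds eta_cont M0 _ tau0 (ltW nq) (le_trans q2 t2) sv fb).
  by move=> p /andP[p0 pq]; apply: hM; rewrite p0 (le_trans pq)// (le_trans qh).
have Ev : `|E (q - h * n%:R) (v (h * n%:R))| <= M * C.
  apply: le_trans (hM _ _ _) _; first by rewrite subr_ge0 (ltW nq) (le_trans qh).
  rewrite ler_wpM2l//; apply: (IH _ _ _ pA sv) => //.
  by rewrite (le_trans _ tau0) ?oppr_le0// (le_trans (ltW nt)).
have le1 : M * (`|B 0| + D * `|v q|) * (q - h * n%:R) <= M * `|B 0| + `|v q| / 2.
  apply: le_trans (_ : _ <= M * (`|B 0| + D * `|v q|) * h) _.
    by rewrite ler_wpM2l// mulr_ge0// addr_ge0// mulr_ge0.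
  rewrite mulrDr mulrDl; apply: lerD; first by rewrite ler_piMr// mulr_ge0.
  rewrite mulrA mulrAC [leRHS]mulrC; apply: ler_wpM2r => //; lra.
have le2 : `|v q| <= M * C + (M * `|B 0| + `|v q| / 2).
  apply: le_trans (_ : _ <= `|E (q - h * n%:R) (v (h * n%:R))| +
      `|v q - E (q - h * n%:R) (v (h * n%:R))|) _.
    by rewrite -{1}[v q](subrKC (E (q - h * n%:R) (v (h * n%:R)))) ler_normD.
  apply: lerD => //.
  exact: le_trans step le1.
by rewrite /C'; lra.
Qed.

Lemma semigroup_near0 (x : H) e : 0 < e ->
  exists2 k : R, 0 < k & forall t, 0 <= t <= k -> `|E t x - x| <= e.
Proof.
move=> e0; have [k k0 h] := (continuous_distP (V := R) _).1
  (semigroup_orbit_continuous C0E (x := x)) 0 e e0.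
exists (k / 2); first by rewrite divr_gt0.
move=> t /andP[t0 tk]; have := h t; rewrite max_l// maxxx (semigroup0 C0E) => h1; apply/ltW/h1.
by rewrite subr0 ger0_norm// (le_lt_trans tk)// ltr_pdivrMr// ltr_pMr// ltr1n.
Qed.

(** Let N be the maximum of |u - v|, reached at q. If q <= 0 it is an initial difference. Otherwise
    the difference of the two equations and the local estimate give N <= e/4 + e/4 + N/2: one e/4
    from the initial values, the other from the term e of the estimate. *)
Lemma local_dependence phi : exists2 k, 0 < k & forall T u, 0 <= T <= k -> sol phi T u ->
  forall e, 0 < e -> exists2 g, 0 < g & forall psi v, sol psi T v -> `|psi - phi| <= g ->
    forall t, - r <= t <= T -> `|u t - v t| <= e.
Proof.
have [rho [k1 [K [rho0 k10 K0 hloc]]]] := local_lipschitz phi.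
have [M M1 hM] := semigroup_bounded C0E 1.
have M0 : 0 < M by exact: lt_le_trans M1.
have [k2 k20 hnear] := history_at_near r_ge0 phi rho0.
have [C C0 hC] := sol_bounded 1 (`|phi| + 1).
pose Cf := `|B 0| + (LB + `|d|) * C.
have Cf0 : 0 <= Cf by rewrite addr_ge0// mulr_ge0// addr_ge0.
have hCf v q : continuous v -> (forall p, q - r <= p <= q -> `|v p| <= C) -> `|forcing v q| <= Cf.
  by move=> cv; exact: forcing_bound.
have rho6 : 0 < rho / 6 by rewrite divr_gt0.
have [k3 k30 horb] := semigroup_near0 (phi 0) rho6.
have MCf : 0 < M * Cf + 1 by rewrite ltr_wpDl// mulr_ge0// ltW.
pose D := K + `|d|; have D0 : 0 <= D by rewrite addr_ge0.
have DE : D = K + `|d| by [].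
have MD : 0 < 2 * (M * D + 1) by rewrite mulr_gt0// ltr_wpDl// mulr_ge0// ltW.
(* The bound 1 is the range of [M]; [k1] and [k2] serve the local estimate and the nearness of
   segments; the next two keep orbit and convolution within rho/6 each; the last yields M D T <=
   1/2. *)
have [|k k0 /and5P[kl1 kk1 kk2 kk3 /and3P[kl4 kl5 _]]] := @exists_pos_le R
    [:: 1; k1; k2; k3; rho / 6 / (M * Cf + 1); (2 * (M * D + 1))^-1].
  by rewrite /= ltr01 k10 k20 k30 !divr_gt0// invr_gt0 MD.
exists k => //.
move=> T u /andP[T0 Tk] su e e0.
have T1 := le_trans Tk kl1; have Tk1 := le_trans Tk kk1; have Tk2 := le_trans Tk kk2.
have Tk3 := le_trans Tk kk3; have Tk4 := le_trans Tk kl4; have Tk5 := le_trans Tk kl5.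
clear kl1 kk1 kk2 kk3 kl4 kl5 Tk.
(* The bound 1 matches the radius [|phi| + 1] in the choice of [C]; rho/4 is the initial distance
   allowed by [history_at_near]; the last makes the third share of rho/6, from the initial
   values. *)
have [|g0 g00 /and4P[g01 g02 g03 _]] := @exists_pos_le R [:: 1; rho / 4; rho / 6 / M].
  by rewrite /= ltr01 !divr_gt0.
clearbody Cf D.
have near psi v : sol psi T v -> `|psi - phi| <= g0 ->
    forall s, 0 <= s <= T -> `|seg v s - phi| <= rho.
  move=> sv p0; have p1 := le_trans p0 g01; have p2 := le_trans p0 g02.
  have p3 := le_trans p0 g03.
  have cv : continuous v by case: sv.
  have v0 : seg v 0 = psi by case: sv.
  apply: (hnear v cv T); [by rewrite T0|by rewrite v0|].
  move=> t /andP[t0 tT].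
  have psiA : `|psi| <= `|phi| + 1.
    by rewrite -[psi](subrKC phi); apply: le_trans (ler_normD _ _) _; rewrite lerD2l.
  have vC q : - r <= q <= T -> `|v q| <= C by exact: (hC _ _ _ T1 psiA sv).
  have fb q : 0 <= q <= t -> `|forcing v q| <= Cf.
    by move=> qt; apply: hCf => // q' q'r; apply: vC; lra.
  have EM q : 0 <= q <= t - 0 -> forall x, `|E q x| <= M * `|x|.
    by rewrite subr0 => /andP[q0 qt]; apply: hM; rewrite q0 (le_trans qt)// (le_trans tT).
  have st := sol_step r_gt0 C0E LB_ge0 B_lip eta_bounds eta_cont (ltW M0) EM (lexx 0) t0 tT sv fb.
  rewrite subr0 in st.
  have st' : M * Cf * t <= rho / 6.
    apply: le_trans (_ : _ <= (M * Cf + 1) * T) _; last by rewrite mulrC -ler_pdivlMr.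
    by apply: ler_pM; rewrite ?mulr_ge0 ?(ltW M0)// lerDl.
  have h2 : `|E t (v 0) - E t (phi 0)| <= rho / 6.
    rewrite -(semigroup_linearB C0E)//; apply: le_trans (hM _ _ _) _.
      by rewrite t0 (le_trans tT).
    rewrite -ler_pdivlMl// mulrC; apply: le_trans p3.
    rewrite (sol_init0 r_gt0 sv); exact: history_sub_le.
  have h3 : `|E t (phi 0) - phi 0| <= rho / 6 by apply: horb; rewrite t0 (le_trans tT).
  apply: le_trans (ler_norm_dist_triangle (E t (phi 0)) _ _) _.
  have := ler_norm_dist_triangle (E t (v 0)) (v t) (E t (phi 0)).
  by lra.
have cu : continuous u by case: su.
have u0 : seg u 0 = phi by case: su.
have e'0 : 0 < e / (4 * M) by rewrite divr_gt0// mulr_gt0.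
have near_phi s : 0 <= s <= T -> `|seg u s - phi| <= rho.
  by apply: (near phi) => //; rewrite subrr normr0 ltW.
have [g1 g10 hg1] := hloc T u Tk1 cu u0 near_phi _ e'0.
have [|g gpos /and4P[gg0 gg1 gg2 _]] := @exists_pos_le R [:: g0; g1; e / (4 * M)].
  by rewrite /= g00 g10 e'0.
exists g => // psi v sv vu.
have cv : continuous v by case: sv.
have v0 : seg v 0 = psi by case: sv.
have diff q : - r <= q <= 0 -> `|u q - v q| <= g.
  move=> qr; rewrite (sol_init su qr) (sol_init sv qr) distrC.
  exact: le_trans (history_sub_le _ _ _) vu.
have [||q qr qmax] := @norm_max R H (fun t => u t - v t) (- r) T.
- by rewrite (le_trans _ T0)// oppr_le0.
- by move=> t; apply: cvgB; [exact: cu|exact: cv].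
move=> t /qmax /le_trans; apply.
have [q1 q2] := andP qr.
have Me : M * (e / (4 * M)) = e / 4 by field; rewrite gt_eqF.
have e4 : e / (4 * M) <= e / 4 by rewrite -Me ler_peMl// ltW.
have [qle0|q0] := leP q 0.
  by apply: le_trans (diff q _) _; [rewrite q1|lra].
set N := `|u q - v q|.
have qT : 0 <= q <= T by rewrite (ltW q0).
have [_ _ /(_ q qT) hu] := su; have [_ _ /(_ q qT) hv] := sv.
have near_v s : 0 <= s <= T -> `|seg v s - phi| <= rho.
  by apply: (near psi) => //; exact: le_trans gg0.
have fb s : 0 <= s <= q -> `|forcing u s - forcing v s| <= e / (4 * M) + D * N.
  move=> /andP[s0 sq]; have sT : 0 <= s <= T by rewrite s0 (le_trans sq).
  have uvN p : - r <= p <= s -> `|u p - v p| <= N.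
    by move=> /andP[p1 p2]; apply: qmax; rewrite p1 (le_trans p2)//; case/andP: sT.
  rewrite /forcing opprD addrACA -opprD -scalerBr DE [(K + _) * N]mulrDl addrA.
  apply: le_trans (ler_normB _ _) _; apply: lerD.
    by apply: (hg1 v cv near_v) => //; rewrite v0 (le_trans vu).
  by rewrite normrZ ler_wpM2l// uvN// lexx andbT (le_trans _ s0)// oppr_le0.
have EM p : 0 <= p <= q -> forall x, `|E p x| <= M * `|x|.
  by move=> /andP[p0 pq]; apply: hM; rewrite p0 (le_trans pq)// (le_trans q2).
have := is_convolution_norm (ltW q0) (ltW M0) EM fb (is_convolutionB C0E hu hv).
set X := u q - _ - _ => hX.
have X' : X = u q - v q - E q (phi 0 - psi 0).
  by rewrite /X (semigroup_linearB C0E) ?(ltW q0)// !opprB addrACA [RHS]addrACA [- v q + _]addrC.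
have hE : `|E q (phi 0 - psi 0)| <= e / 4.
  apply: le_trans (hM _ _ _) _; first by rewrite (ltW q0) (le_trans q2).
  rewrite -Me ler_wpM2l ?(ltW M0)//.
  apply: le_trans _ gg2; apply: le_trans _ vu; rewrite distrC; exact: history_sub_le.
have hN : N <= `|X| + `|E q (phi 0 - psi 0)|.
  by rewrite /N -[u q - v q](subrK (E q (phi 0 - psi 0))) -X'; exact: ler_normD.
have MDq : M * D * q <= 1 / 2.
  apply: le_trans (_ : _ <= (M * D + 1) * T) _.
    by apply: ler_pM; rewrite ?mulr_ge0 ?(ltW M0) ?(ltW q0)// lerDl.
  move: Tk5; rewrite -[_^-1]mul1r ler_pdivlMr//; lra.
have hX2 : M * (e / (4 * M) + D * N) * q <= e / 4 + N / 2.
  rewrite mulrDr mulrDl Me; apply: lerD.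
    by rewrite ler_piMr ?divr_ge0 ?(ltW e0)// (le_trans q2).
  rewrite mulrA [_ * N * q]mulrAC [leRHS]mulrC; apply: ler_wpM2r; first exact: normr_ge0.
  by rewrite -[leRHS]mul1r.
by have hX3 := le_trans hX hX2; lra.
Qed.


(** The radii found at times s < t might shrink to 0 as s approaches t. A single time [a] just
    before [t] suffices, because over [a, t] every solution with nearby data stays within e/4 of a
    semigroup orbit. *)
Lemma global_dependence phi T u : 0 <= T -> sol phi T u ->
  forall e, 0 < e -> exists2 g, 0 < g & forall psi v, sol psi T v -> `|psi - phi| <= g ->
    forall t, - r <= t <= T -> `|u t - v t| <= e.
Proof.
move=> T0 su; have cu : continuous u by case: su.
pose P t := forall e : R, 0 < e -> exists2 g : R, 0 < g & forall psi v, sol psi t v ->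
  `|psi - phi| <= g -> forall s, - r <= s <= t -> `|u s - v s| <= e.
apply: (@real_induction R P T T0) => [e e0|t t0 tT Pt|t t0 tT Pl e e0].
- exists e => // psi v sv pe s sr; rewrite (sol_init su sr) (sol_init sv sr) distrC.
  exact: le_trans (history_sub_le _ _ _) pe.
- have [k k0 hk] := local_dependence (seg u t); exists k => // s /andP[ts stk] sT e e0.
  have tT' : 0 <= t <= s by rewrite t0.
  have su' := sol_shift r_gt0 C0E LB_ge0 B_lip eta_bounds eta_cont tT' (sol_le sT su).
  (* Closeness up to [t] is required at level [g1] as well, so that the segments at [t] are
     admissible initial data for the local statement. *)
  have [|g1 g10 hg1] := hk (s - t) _ _ su' e e0; first by rewrite subr_ge0 ts lerBlDl.
  have [|g g0 hg] := Pt (Num.min e g1); first by rewrite lt_min e0.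
  exists g => // psi v sv pg; have cv : continuous v by case: sv.
  have vt q : - r <= q <= t -> `|u q - v q| <= Num.min e g1 by exact: hg (sol_le ts sv) pg q.
  move=> q /andP[q1 q2]; have [qt|tq] := leP q t.
    by have := vt q; rewrite q1 qt le_min => /(_ isT)/andP[].
  rewrite -[q](subrK t); have sv' := sol_shift r_gt0 C0E LB_ge0 B_lip eta_bounds eta_cont tT' sv.
  apply: (hg1 _ _ sv'); last by rewrite lerB// andbT (@le_trans _ _ 0) ?oppr_le0// subr_ge0 ltW.
  apply: history_at_dist => // [|p /andP[p1 p2]]; first exact: ltW.
  rewrite distrC; have := vt (t + p); rewrite le_min => /(_ _)/andP[]//.
  by rewrite gerDl p2 andbT (le_trans p1)// lerDr.
have [M M1 hM] := semigroup_bounded C0E 1.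
have M0 : 0 < M by exact: lt_le_trans M1.
have [C C0 hC] := sol_bounded T (`|phi| + 1).
have [Cf Cf0 hCf] : exists2 Cf, 0 <= Cf & forall v q, continuous v ->
    (forall p, q - r <= p <= q -> `|v p| <= C) -> `|forcing v q| <= Cf.
  exists (`|B 0| + (LB + `|d|) * C); first by rewrite addr_ge0// mulr_ge0// addr_ge0.
  by move=> v q cv; exact: forcing_bound.
have MCf : 0 < M * Cf + 1 by rewrite ltr_wpDl// mulr_ge0// ltW.
have e40 : 0 < e / 4 by rewrite divr_gt0.
have [|k k0 /and3P[k1 k2 _]] := @exists_pos_le R [:: 1; e / 4 / (M * Cf + 1)].
  by rewrite /= ltr01 divr_gt0.
(* On [a, t] the two deviations from orbits cost e/4 each, and [M] times the difference at [a] costs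
   e/2. *)
pose a := Num.max 0 (t - k).
have a0 : 0 <= a by rewrite le_max lexx.
have at_ : a < t by rewrite gt_max t0 gtrBl.
have tak : t - a <= k by rewrite lerBlDr -lerBlDl le_max lexx orbT.
have ta1 : t - a <= 1 by exact: le_trans tak k1.
have MCfk : M * Cf * (t - a) <= e / 4.
  apply: le_trans (_ : _ <= (M * Cf + 1) * k) _; last by rewrite mulrC -ler_pdivlMr.
  by apply: ler_pM; rewrite ?mulr_ge0 ?(ltW M0) ?subr_ge0 ?(ltW at_)// lerDl.
have e20 : 0 < e / 2 by rewrite divr_gt0.
have e2M : e / 2 / M <= e / 2 by rewrite ler_pdivrMr// ler_peMr// ltW.
have [||g g0 hg] := Pl a _ (e / 2 / M); [by rewrite a0|by rewrite divr_gt0|].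
have [|g' g'0 /and3P[gg g1 _]] := @exists_pos_le R [:: g; 1]; first by rewrite /= g0 ltr01.
exists g' => // psi v sv pg q /andP[q1 q2].
have va p : - r <= p <= a -> `|u p - v p| <= e / 2 / M.
  exact: hg (sol_le (ltW at_) sv) (le_trans pg gg) p.
have [qa|aq] := leP q a.
  by apply: le_trans (va q _) _; [rewrite q1|rewrite (le_trans e2M)// ler_pdivrMr// ler_peMr ?ler1n// ltW].
have qaT : q - a <= t - a by rewrite lerB.
have EM p : 0 <= p <= q - a -> forall x, `|E p x| <= M * `|x|.
  by move=> /andP[p0 pq]; apply: hM; rewrite p0 (le_trans pq)// (le_trans qaT).
have step psi' v' : `|psi'| <= `|phi| + 1 -> sol psi' t v' ->
    `|v' q - E (q - a) (v' a)| <= e / 4.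
  move=> pA sv'; apply: le_trans _ MCfk.
  apply: le_trans (_ : _ <= M * Cf * (q - a)) _; last first.
    by rewrite ler_wpM2l// mulr_ge0// ltW.
  apply: (sol_step r_gt0 C0E LB_ge0 B_lip eta_bounds eta_cont (ltW M0) EM a0 (ltW aq) q2 sv').
  move=> p /andP[p1 p2]; apply: hCf => [|p' /andP[p'1 p'2]]; first by case: sv'.
  apply: (hC _ _ _ tT pA sv'); rewrite (le_trans p'2) ?(le_trans p2)// andbT.
  by rewrite (le_trans _ p'1)// lerBrDr addNr (le_trans a0).
have su_ := step phi u _ (sol_le tT su); have sv_ := step psi v _ sv.
have {}su_ : `|u q - E (q - a) (u a)| <= e / 4 by apply: su_; rewrite lerDl.
have {}sv_ : `|v q - E (q - a) (v a)| <= e / 4.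
  apply: sv_; rewrite -[psi](subrKC phi); apply: le_trans (ler_normD _ _) _.
  by rewrite lerD2l (le_trans pg).
have h3 : `|E (q - a) (u a) - E (q - a) (v a)| <= e / 2.
  rewrite -(semigroup_linearB C0E) ?subr_ge0 ?(ltW aq)//.
  apply: le_trans (EM _ _ _) _; first by rewrite lexx subr_ge0 ltW.
  by rewrite mulrC -ler_pdivlMr// va// lexx andbT (le_trans _ a0)// oppr_le0.
apply: le_trans (ler_norm_dist_triangle (E (q - a) (u a)) _ _) _.
have := ler_norm_dist_triangle (E (q - a) (v a)) (E (q - a) (u a)) (v q).
by rewrite [`|_ (v a) - v q|]distrC; lra.
Qed.

(** * Uniqueness, gluing and existence *)

Lemma sol_unique phi T u v : 0 <= T -> sol phi T u -> sol phi T v ->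
  forall t, - r <= t <= T -> u t = v t.
Proof.
move=> T0 su sv t tr; apply/eqP; rewrite -subr_eq0 -normr_le0.
apply/ler_addgt0Pr => e e0; rewrite add0r.
have [g g0 hg] := global_dependence T0 su e0; apply: hg sv _ t tr.
by rewrite subrr normr0 ltW.
Qed.

Lemma sol_glue phi T k u w : 0 <= T -> 0 <= k -> sol phi T u -> sol (seg u T) k w ->
  exists z, sol phi (T + k) z.
Proof.
move=> T0 k0 su sw; have cu : continuous u by case: su.
have cw : continuous w by case: sw.
(* One formula, visibly continuous: up to [T] the bracket vanishes because [w 0 = u T]; after [T]
   the value [u T] cancels and [w (t - T)] remains. *)
pose z t := u (Num.min t T) + (w (Num.max (t - T) 0) - u T).
have w0 q : - r <= q <= 0 -> w q = u (T + q).
  by move=> qr; rewrite (sol_init sw qr) history_atC.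
have zl t : t <= T -> z t = u t.
  move=> tT; rewrite /z min_l// max_r ?subr_le0// w0 ?lexx ?oppr_le0 ?r_ge0//.
  by rewrite addr0 subrr addr0.
have zr t : - r <= t -> z (t + T) = w t.
  move=> rt; have [t0|t0] := leP t 0.
    by rewrite zl ?gerDr// w0 ?rt// addrC.
  rewrite /z min_r; last by rewrite lerDr ltW.
  by rewrite addrK max_l ?(ltW t0)// subrKC.
have cz : continuous z.
  apply/(continuous_distP (V := R)) => t e e0.
  have e20 : 0 < e / 2 by rewrite divr_gt0.
  have [k1 k10 h1] := (continuous_distP (V := R) _).1 cu (Num.min t T) _ e20.
  have [k2 k20 h2] := (continuous_distP (V := R) _).1 cw (Num.max (t - T) 0) _ e20.
  exists (Num.min k1 k2); first by rewrite lt_min k10.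
  move=> s; rewrite lt_min => /andP[s1 s2].
  have dmin := ler_dist_min T s t.
  have dmax : `|Num.max (s - T) 0 - Num.max (t - T) 0| <= `|s - t|.
    by apply: le_trans (ler_dist_max _ _ _) _; rewrite opprB addrA subrK.
  have -> : z s - z t = (u (Num.min s T) - u (Num.min t T)) +
      (w (Num.max (s - T) 0) - w (Num.max (t - T) 0)).
    by rewrite /z opprD addrACA; congr (_ + _); rewrite opprB subrKA.
  apply: le_lt_trans (ler_normD _ _) _; rewrite [ltRHS]splitr.
  by apply: ltrD; [apply: h1|apply: h2]; [exact: le_lt_trans s1|exact: le_lt_trans s2].
have fl s : s <= T -> forcing z s = forcing u s.
  move=> sT; apply: eq_forcing => // q /andP[_ q0]; apply: zl.
  by rewrite (le_trans _ sT)// gerDl.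
have fr s : 0 <= s -> forcing z (s + T) = forcing w s.
  move=> s0; apply: eq_forcing => // q /andP[q1 q2].
  by rewrite addrAC zr// (le_trans q1)// lerDr.
exists z; split=> // [|t /andP[t0 tk]].
  by case: su => _ <- _; apply: eq_history_at => q /andP[q1 q2]; rewrite zl// add0r (le_trans q2).
have [_ _ hu] := su; have [_ _ hw] := sw.
have [tT|Tt] := leP t T.
  rewrite zl//; apply: is_convolution_ext (hu t _); last by rewrite t0.
  by move=> s /andP[s0 st]; rewrite fl// (le_trans st).
have tT0 : 0 <= t - T by rewrite subr_ge0 ltW.
have cf := forcing_continuous (d := d) r_gt0 LB_ge0 B_lip eta_bounds eta_cont cz.
have [K hK] := is_convolution_exists C0E cf t0.
suff -> : z t - E t (phi 0) = K by [].
have hI : is_convolution E (forcing z) T (u T - E T (phi 0)).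
  apply: is_convolution_ext (hu T _); last by rewrite T0 lexx.
  by move=> s /andP[_ sT]; rewrite fl.
have hJ : is_convolution E (fun q => forcing z (q + T)) (t - T) (w (t - T) - E (t - T) (seg u T 0)).
  apply: is_convolution_ext (hw (t - T) _); last by rewrite tT0 lerBlDl.
  by move=> s /andP[s0 _]; rewrite fr.
have hK' : is_convolution E (forcing z) (T + (t - T)) K by rewrite subrKC.
rewrite (is_convolutionD C0E cf T0 tT0 hI hJ hK') history_atC ?lexx ?oppr_le0 ?r_ge0// addr0.
rewrite (semigroup_linearB C0E)// -(semigroupD C0E)// subrK.
rewrite -[in LHS](subrK T t) zr ?subrK; last by rewrite (le_trans _ tT0)// oppr_le0.
by rewrite addrC [in RHS]addrC addrA subrK addrC.
Qed.


Lemma convolution0 f : convolution E f 0 = 0.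
Proof.
suff h : is_convolution E f 0 0 by apply: (is_convolution_unique (lexx 0) _ h); apply: xgetPex; exists 0.
apply/is_RIntP => e e0; exists 1 => // m x tag P; rewrite subr0 /riemann_sum big1 ?normr0// => i _.
have /andP[h1 h2] := tagged_partition_itv P (ltnW (ltn_ord i)).
have /andP[h3 h4] := tagged_partition_itv P (ltn_ord i).
by rewrite (_ : x i.+1 - x i = 0) ?scale0r//; lra.
Qed.

Lemma local_existence phi : exists k u, 0 < k /\ sol phi k u.
Proof.
have [rho [k1 [K [rho0 k10 K0 hloc]]]] := local_lipschitz phi.
have [M M1 hM] := semigroup_bounded C0E 1.
have M0 : 0 < M by exact: lt_le_trans M1.
have [k2 k20 hnear] := history_at_near r_ge0 phi rho0.
have C0 : 0 <= `|phi| + rho by rewrite addr_ge0// ltW.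
have [Cf Cf0 hCf] : exists2 Cf, 0 <= Cf & forall v q, continuous v ->
    (forall p, q - r <= p <= q -> `|v p| <= `|phi| + rho) -> `|forcing v q| <= Cf.
  exists (`|B 0| + (LB + `|d|) * (`|phi| + rho)); first by rewrite addr_ge0// mulr_ge0// addr_ge0.
  by move=> v q cv; exact: forcing_bound.
have rho4 : 0 < rho / 4 by rewrite divr_gt0.
have [k3 k30 horb] := semigroup_near0 (phi 0) rho4.
have MCf : 0 < M * Cf + 1 by rewrite ltr_wpDl// mulr_ge0// ltW.
have D0 : 0 <= K + `|d| by rewrite addr_ge0.
have MD : 0 < 2 * (M * (K + `|d|) + 1) by rewrite mulr_gt0// ltr_wpDl// mulr_ge0// ltW.
(* Orbit and convolution move by at most rho/4 each, so iterates stay within rho/2 of [phi 0]; the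
   last bound gives the contraction factor 1/2. *)
have [|T T0 /and5P[T1 Tk1 Tk2 Tk3 /and3P[Tk4 Tk5 _]]] := @exists_pos_le R
    [:: 1; k1; k2; k3; rho / 4 / (M * Cf + 1); (2 * (M * (K + `|d|) + 1))^-1].
  by rewrite /= ltr01 k10 k20 k30 !divr_gt0// invr_gt0 MD.
have T_ge0 := ltW T0.
pose x t := phi (clamp (- r) 0 t).
have cx : continuous x by exact: history_clamp_continuous.
pose c t := clamp 0 T t.
have c_itv t : 0 <= c t <= T by exact: clamp_itv.
have cc : continuous c by exact: clamp_continuous.
(* The Picard map, defined on all of [R]: for [t <= 0] the clamped time is 0 and [x t] remains; on
   [[0, T]], [x t = phi 0] cancels and the mild formula remains. *)
pose G u t := x t - phi 0 + (E (Num.max (c t) 0) (phi 0) +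
  convolution E (forcing u) (Num.max (c t) 0)).
have GE u t : G u t = x t - phi 0 + (E (c t) (phi 0) + convolution E (forcing u) (c t)).
  by rewrite /G max_l//; case/andP: (c_itv t).
have EM t : 0 <= t <= T -> forall y, `|E t y| <= M * `|y|.
  by move=> /andP[t0 tT]; apply: hM; rewrite t0 (le_trans tT).
(* The set stable under [G] on which the local estimate applies. *)
pose adm u := [/\ continuous u, seg u 0 = phi & forall t, 0 <= t <= T -> `|u t - phi 0| <= rho / 2].
have adm_near u : adm u -> forall s, 0 <= s <= T -> `|seg u s - phi| <= rho.
  move=> [cu u0 uT]; apply: (hnear u cu T) => //; first by rewrite T_ge0.
  by rewrite u0 subrr normr0 ltW.
have adm_forcing u : adm u -> forall s, 0 <= s <= T -> `|forcing u s| <= Cf.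
  move=> au s /andP[s0 sT]; have [cu u0 uT] := au; apply: hCf => // p /andP[p1 p2].
  have [p0|p0] := leP p 0.
    rewrite ((history_at0 phi cu).1 u0) ?p0 ?andbT.
      by apply: le_trans (history_le_norm _ _) _; rewrite lerDl ltW.
    by rewrite (le_trans _ p1)// lerBrDr addNr.
  rewrite -[u p](subrKC (phi 0)); apply: le_trans (ler_normD _ _) _.
  apply: lerD; first exact: history_le_norm.
  apply: le_trans (uT p _) _; first by rewrite (ltW p0) (le_trans p2).
  by rewrite ler_pdivrMr// ler_peMr ?ler1n// ltW.
have cf u : continuous u -> continuous (forcing u).
  exact: (forcing_continuous (d := d) r_gt0 LB_ge0 B_lip eta_bounds eta_cont).
have MCT t : 0 <= t <= T -> M * Cf * t <= rho / 4.
  move=> /andP[t0 tT]; apply: le_trans (_ : _ <= (M * Cf + 1) * T) _.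
    by apply: ler_pM; rewrite ?mulr_ge0 ?(ltW M0)// lerDl.
  by rewrite mulrC -ler_pdivlMr.
have MDT t : 0 <= t <= T -> M * (K + `|d|) * t <= 2^-1.
  move=> /andP[t0 tT]; apply: le_trans (_ : _ <= (M * (K + `|d|) + 1) * T) _.
    by apply: ler_pM; rewrite ?mulr_ge0 ?(ltW M0)// lerDl.
  by rewrite -ler_pdivlMl -?invfM ?[_ * 2]mulrC//; move: MD; rewrite pmulr_rgt0.
have conv_bound u : adm u -> forall t, 0 <= t <= T -> `|convolution E (forcing u) t| <= rho / 4.
  move=> au t tT; have [cu _ _] := au; apply: le_trans _ (MCT t tT).
  have [t0 tT'] := andP tT.
  apply: (is_convolution_norm t0 (ltW M0) _ _ (convolutionP C0E (cf _ cu) t0)).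
    by move=> s /andP[s0 st]; apply: EM; rewrite s0 (le_trans st).
  by move=> s /andP[s0 st]; apply: adm_forcing => //; rewrite s0 (le_trans st).
have G_dist u : adm u -> forall t, `|G u t - x t| <= rho / 2.
  move=> au t.
  have -> : G u t - x t = (E (c t) (phi 0) - phi 0) + convolution E (forcing u) (c t).
    by rewrite GE addrAC [x t - phi 0]addrC addrK addrA [- phi 0 + _]addrC.
  apply: le_trans (ler_normD _ _) _; have -> : rho / 2 = rho / 4 + rho / 4 by lra.
  apply: lerD; last exact: conv_bound.
  by apply: horb; case/andP: (c_itv t) => -> /le_trans; exact.
have x_pos t : 0 <= t -> x t = phi 0.
  by move=> t0; rewrite /x /clamp min_r// max_r// oppr_le0.
have admG u : adm u -> adm (G u).
  move=> au; have [cu _ _] := au; have cG : continuous (G u).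
    move=> t; apply: cvgD; first by apply: cvgB; [exact: cx|exact: cvg_cst].
    apply: cvgD.
      exact: (continuous_comp_real cc (semigroup_orbit_continuous C0E (x := phi 0))).
    exact: (continuous_comp_real cc (convolution_continuous C0E (cf _ cu))).
  split=> //.
    apply/history_at0 => // s sr; rewrite GE.
    have -> : c s = 0 by rewrite /c /clamp max_l// ge_min; case/andP: sr => _ ->.
    by rewrite convolution0 (semigroup0 C0E) addr0 subrK /x clamp_id.
  by move=> t /andP[t0 tT]; rewrite -(x_pos _ t0); exact: G_dist.
have G_contract u v N : adm u -> adm v -> (forall t, `|u t - v t| <= N) ->
    forall t, `|G u t - G v t| <= N / 2.
  move=> au av uvN t; have N0 : 0 <= N by exact: le_trans (normr_ge0 _) (uvN 0).
  have [cu u0 _] := au; have [cv v0 _] := av.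
  have [c0 cT] := andP (c_itv t).
  rewrite !GE opprD addrACA subrr add0r opprD addrACA subrr add0r.
  have fb s : 0 <= s <= c t -> `|forcing u s - forcing v s| <= (K + `|d|) * N.
    move=> /andP[s0 sc]; rewrite /forcing opprD addrACA -opprD -scalerBr mulrDl.
    apply: le_trans (ler_normB _ _) _; apply: lerD; last by rewrite normrZ ler_wpM2l.
    (* Both curves start exactly from [phi], so the estimate holds for every [e > 0], and [e]
       disappears. *)
    apply/ler_addgt0Pr => e e0; rewrite [leRHS]addrC.
    have sT : 0 <= s <= T by rewrite s0 (le_trans sc).
    have [g g0 hg] := hloc T u Tk1 cu u0 (adm_near u au) e e0.
    by apply: (hg v cv (adm_near v av)) => //; rewrite v0 subrr normr0 ltW.
  have := is_convolution_norm c0 (ltW M0) _ fb (is_convolutionB C0E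
    (convolutionP C0E (cf _ cu) c0) (convolutionP C0E (cf _ cv) c0)).
  move=> /(_ _)/le_trans; apply.
    by move=> s /andP[s0 st]; apply: EM; rewrite s0 (le_trans st).
  by rewrite mulrA [_ * N * _]mulrAC [leRHS]mulrC ler_wpM2r// MDT// c0.
have admx : adm x.
  split=> //; first exact: history_at_clamp.
  by move=> t /andP[t0 _]; rewrite x_pos// subrr normr0 divr_ge0// ltW.
pose U n := iter n G x.
have admU n : adm (U n) by elim: n => //= n; exact: admG.
have U_step n t : `|U n.+1 t - U n t| <= rho / 2 * 2^-1 ^+ n.
  elim: n t => [|n IH] t; first by rewrite expr0 mulr1; exact: G_dist.
  by rewrite exprSr mulrA; exact: (G_contract _ _ _ (admU n.+1) (admU n) IH).
(* The rate is uniform in [t]; hence continuity and admissibility pass to the limit. *)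
have /choice[l hl] t : exists y, forall n, `|y - U n t| <= rho * 2^-1 ^+ n.
  have [y hy] := geometric_cvg (U_step ^~ t); exists y => n.
  by have := hy n; rewrite [2 * _]mulrC divfK.
have cl : continuous l.
  apply/(continuous_distP (V := R)) => t e e0.
  have e30 : 0 < e / 3 by rewrite divr_gt0.
  have [n hn] := geometric_small rho e30; have [cU _ _] := admU n.
  have [k k0 hk] := (continuous_distP (V := R) _).1 cU t _ e30.
  exists k => // s /hk h; have h1 := le_lt_trans (hl s n) hn; have h2 := le_lt_trans (hl t n) hn.
  have h3 := ler_norm_dist_triangle (U n s) (l s) (l t).
  have h4 := ler_norm_dist_triangle (U n t) (U n s) (l t).
  by rewrite [`|U n t - l t|]distrC in h4; lra.
have al : adm l.
  split=> // [|t tT].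
    apply/history_at0 => // s sr; apply/eqP; rewrite -subr_eq0; apply/eqP.
    apply: (geometric_eq0 (C := rho)) => n; have [cU U0 _] := admU n.
    by rewrite -((history_at0 phi cU).1 U0 s sr); exact: hl.
  apply/ler_addgt0Pr => e e0; have [n hn] := geometric_small rho e0.
  have [_ _ /(_ t tT) Un] := admU n; rewrite [leRHS]addrC.
  apply: le_trans (ler_norm_dist_triangle (U n t) _ _) _; apply: lerD => //.
  by rewrite ltW// (le_lt_trans (hl t n)).
have fixl t : l t = G l t.
  apply/eqP; rewrite -subr_eq0; apply/eqP; apply: (geometric_eq0 (C := rho)) => n.
  apply: le_trans (ler_norm_dist_triangle (U n.+1 t) _ _) _.
  have h1 := hl t n.+1; have h2 : `|U n.+1 t - G l t| <= rho * 2^-1 ^+ n / 2.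
    by apply: G_contract => // s; rewrite distrC.
  by rewrite exprSr mulrA in h1; lra.
exists T, l; split=> //; case: (al) => _ l0 _; split=> // t tT.
have [t0 _] := andP tT.
rewrite fixl GE x_pos// subrr add0r /c clamp_id// addrC addKr.
exact: (convolutionP C0E (cf _ cl)).
Qed.


(** At a limit time [t], uniqueness merges the solutions on [0, s], s < t, into one curve [y]. A
    bound independent of s makes [y] an approximate orbit, hence convergent at [t] from the left;
    the equation at [t] follows by continuity. *)
Lemma global_existence phi T : 0 <= T -> exists u, sol phi T u.
Proof.
move=> T0; apply: (@real_induction R (fun T => exists u, sol phi T u) T T0).
- exists (fun t => phi (clamp (- r) 0 t)).
  split=> [||t /andP[t0 t0']]; first exact: history_clamp_continuous.
    exact: history_at_clamp.
  have -> : t = 0 by apply/eqP; rewrite eq_le t0'.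
  rewrite clamp_id ?lexx ?oppr_le0 ?r_ge0// (semigroup0 C0E) subrr -(convolution0 (forcing (fun t => phi (clamp (- r) 0 t)))).
  apply: (convolutionP C0E) => //; apply: (forcing_continuous r_gt0 LB_ge0) => //.
  exact: history_clamp_continuous.
- move=> t t0 tT [u su]; have [k [w [k0 sw]]] := local_existence (seg u t).
  have [z sz] := sol_glue t0 (ltW k0) su sw.
  by exists k => // s /andP[_ stk] _; exists z; exact: sol_le sz.
move=> t t0 tT Pl.
have /choice[U hU] s : exists u, 0 <= s < t -> sol phi s u.
  have [st|st] := boolP (0 <= s < t); last by exists (cst 0).
  by have [u su] := Pl s st; exists u.
(* The value at [q] is read on the solution chosen up to time [q] itself; by uniqueness any longer
   one gives the same. Times before [- r] are sent to [- r]. *)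
pose y q := U (Num.max q 0) (Num.max q (- r)).
have yE s q : 0 <= s < t -> q <= s -> y q = U s (Num.max q (- r)).
  move=> /andP[s0 st] qs; have q0 : 0 <= Num.max q 0 by rewrite le_max lexx orbT.
  have qs' : Num.max q 0 <= s by rewrite ge_max qs.
  apply: (sol_unique q0 (hU _ _)); first by rewrite q0 (le_lt_trans qs').
    by apply: sol_le qs' (hU _ _); rewrite s0.
  rewrite le_max lexx orbT/= ge_max le_max lexx/= (le_trans _ q0)// oppr_le0//.
have yU s q : 0 <= s < t -> - r <= q <= s -> y q = U s q.
  by move=> st /andP[rq qs]; rewrite (yE s)// max_l.
have [M M1 hM] := semigroup_bounded C0E t.
have M0 : 0 <= M by exact: le_trans M1.
have [C C0 hC] := sol_bounded t `|phi|.
have [Cf Cf0 hCf] : exists2 Cf, 0 <= Cf & forall v q, continuous v ->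
    (forall p, q - r <= p <= q -> `|v p| <= C) -> `|forcing v q| <= Cf.
  exists (`|B 0| + (LB + `|d|) * C); first by rewrite addr_ge0// mulr_ge0// addr_ge0.
  by move=> v q cv; exact: forcing_bound.
have MCf0 : 0 <= M * Cf by exact: mulr_ge0.
have osc e : 0 < e -> exists2 k, 0 < k & forall s s', 0 <= s -> 0 <= s' ->
    s < t -> s' < t -> `|s - t| < k -> `|s' - t| < k -> `|y s - y s'| < e.
  apply: (approximate_orbit_osc C0E (D := fun s => s < t) MCf0 _ (ltW t0)) => s q s0 sq qt.
  have q0 := le_trans s0 sq; have qt' : 0 <= q < t by rewrite q0.
  have sq_ := hU q qt'.
  rewrite !(yU q)// ?lexx ?sq ?andbT; [|by rewrite (le_trans _ s0)// oppr_le0|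
    by rewrite (le_trans _ q0)// oppr_le0].
  apply: (sol_step r_gt0 C0E LB_ge0 B_lip eta_bounds eta_cont M0 _ s0 sq (lexx q) sq_).
    by move=> p /andP[p0 pqs]; apply: hM; rewrite p0 (le_trans pqs)// lerBlDr (le_trans (ltW qt))// lerDl.
  move=> p /andP[sp pq]; apply: hCf => [|p' /andP[p'1 p'2]]; first by case: sq_.
  apply: (hC _ _ _ (ltW qt) (lexx _) sq_); rewrite (le_trans p'2 pq) andbT.
  by rewrite (le_trans _ p'1)// lerBrDr addNr (le_trans s0).
have [l hl] : exists l, forall e, 0 < e -> exists2 k, 0 < k & forall s, 0 <= s -> s < t ->
    `|s - t| < k -> `|y s - l| < e.
  have near_left k : 0 < k -> \forall s \near t^'-, [/\ 0 <= s, s < t & `|s - t| < k].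
    move=> k0; near=> s; have st : s < t by near: s; exact: nbhs_left_lt.
    split=> //; first by near: s; exact: nbhs_left_ge.
    rewrite distrC gtr0_norm ?subr_gt0// ltrBlDr -ltrBlDl.
    by near: s; apply: nbhs_left_gt; rewrite gtrBl.
  have /cauchy_cvgP/cvg_ex[l yl] : cauchy (y @ t^'-).
    apply: cauchy_exP => e e0; have [k k0 hk] := osc e e0.
    have [s0 [s00 s0t s0k]] := filter_ex (near_left k k0); exists (y s0).
    apply: filterS (near_left k k0) => s [s1 s2 s3]; rewrite /= -ball_normE/=.
    exact: hk.
  exists l => e e0; have e20 : 0 < e / 2 by rewrite divr_gt0.
  have [k k0 hk] := osc _ e20; exists k => // s s1 s2 s3.
  have /cvgrPdist_lt/(_ _ e20) yle := yl.
  have [s' [[s'1 s'2 s'3] s'4]] := filter_ex (filterI (near_left k k0) yle).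
  apply: le_lt_trans (ler_norm_dist_triangle (y s') _ _) _; rewrite [ltRHS]splitr.
  by apply: ltrD; [exact: hk|rewrite distrC].
pose z s := if s < t then y s else l.
have cz : continuous z.
  apply/(continuous_distP (V := R)) => a e e0; have [at_|ta] := ltP a t.
    pose s := (Num.max a 0 + t) / 2.
    have mat : Num.max a 0 < t by rewrite gt_max at_.
    have ma0 : 0 <= Num.max a 0 by rewrite le_max lexx orbT.
    have st : 0 <= s < t by rewrite /s; apply/andP; split; lra.
    have amax : a <= Num.max a 0 by rewrite le_max lexx.
    have as_ : a < s by rewrite /s; lra.
    have [cU _ _] := hU s st.
    have [k k0 hk] := (continuous_distP (V := R) _).1 cU (Num.max a (- r)) _ e0.
    exists (Num.min k (s - a)); first by rewrite lt_min k0 subr_gt0.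
    move=> q; rewrite lt_min => /andP[qk qsa].
    have qs : q < s by move: qsa; rewrite ltr_distl => /andP[_]; rewrite subrKC.
    have [s0 s1] := andP st.
    rewrite /z (lt_trans qs s1) at_ !(yE s)// ?(ltW qs) ?(ltW as_)//.
    by apply: hk; exact: le_lt_trans (ler_dist_max _ _ _) qk.
  have [at_|at_] := eqVneq a t.
    have [k k0 hk] := hl e e0; exists (Num.min k t); first by rewrite lt_min k0.
    move=> q; rewrite at_ lt_min => /andP[qk qt]; rewrite /z ltxx.
    case: (ltP q t) => [qt'|_]; last by rewrite subrr normr0.
    by apply: hk => //; move: qt; rewrite ltr_distl subrr => /andP[/ltW].
  have {at_}at_ : t < a by rewrite lt_neqAle eq_sym at_.
  exists (a - t); first by rewrite subr_gt0.
  move=> q; rewrite ltr_distl => /andP[+ _]; rewrite subKr => tq.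
  have -> : z q = l by rewrite /z ltNge (ltW tq).
  have -> : z a = l by rewrite /z ltNge ta.
  by rewrite subrr normr0.
have sz s : 0 <= s < t -> sol phi s z.
  move=> st; have [s0 s1] := andP st; apply: (sol_ext r_gt0 s0 cz _ (hU s st)) => q /andP[q1 q2].
  by rewrite /z (le_lt_trans q2 s1) (yU s)// q1.
exists z; split=> //; first by case: (sz 0); rewrite ?lexx.
have cf := forcing_continuous (d := d) r_gt0 LB_ge0 B_lip eta_bounds eta_cont cz.
(* The defect in the mild equation: continuous, zero on [0, t), hence zero at [t]. *)
pose D s := z s - (E (Num.max s 0) (phi 0) + convolution E (forcing z) (Num.max s 0)).
have cD : continuous D.
  move=> s; apply: cvgB; first exact: cz.
  apply: cvgD; first exact: (semigroup_orbit_continuous C0E).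
  exact: (convolution_continuous C0E cf).
have D0 s : 0 <= s < t -> D s = 0.
  move=> st; have [s0 s1] := andP st; have [_ _ /(_ s)] := sz s st.
  rewrite s0 lexx => /(_ isT) h; rewrite /D max_l//.
  rewrite -(is_convolution_unique s0 h (convolutionP C0E cf s0)).
  by rewrite subrKC subrr.
have Dt : D t = 0.
  apply/eqP; rewrite -normr_le0; apply/ler_addgt0Pr => e e0; rewrite add0r.
  have [k k0 hk] := (continuous_distP (V := R) _).1 cD t e e0.
  pose s := Num.max 0 (t - k / 2).
  have k20 : 0 < k / 2 by rewrite divr_gt0.
  have st : 0 <= s < t by rewrite /s le_max lexx gt_max t0/= gtrBl.
  have := hk s; rewrite (D0 s st) sub0r normrN => h; apply/ltW/h.
  rewrite ltr_distl; have [s0 s1] := andP st; rewrite (lt_le_trans s1) ?lerDl ?(ltW k0)// andbT.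
  have : t - k / 2 <= s by rewrite le_max lexx orbT.
  by move=> h1; apply: lt_le_trans h1; rewrite ltrD2l ltrN2 ltr_pdivrMr// ltr_pMr// ltr1n.
move=> s /andP[s0]; rewrite le_eqVlt => /predU1P[->|st].
  have := Dt; rewrite /D max_l ?(ltW t0)// => /eqP; rewrite subr_eq0 => /eqP->.
  by rewrite addrC addKr; exact: (convolutionP C0E cf (ltW t0)).
have hs : 0 <= s < t by rewrite s0.
by have [_ _ h] := sz s hs; apply: h; rewrite s0 lexx.
Unshelve. all: by end_near. Qed.


Lemma global_sol phi : exists u, forall T, 0 <= T -> sol phi T u.
Proof.
have /choice[U hU] T : exists u, 0 <= T -> sol phi T u.
  have [T0|T0] := boolP (0 <= T); last by exists (cst 0).
  by have [u su] := global_existence phi T0; exists u.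
(* Each [q] is read at its own horizon. Near a point [a] the single horizon [|a| + 1] describes [u],
   which gives continuity. *)
pose u q := U (Num.max q 0) (Num.max q (- r)).
have uE T q : 0 <= T -> q <= T -> u q = U T (Num.max q (- r)).
  move=> T0 qT; have q0 : 0 <= Num.max q 0 by rewrite le_max lexx orbT.
  have qT' : Num.max q 0 <= T by rewrite ge_max qT.
  apply: (sol_unique q0 (hU _ q0) (sol_le qT' (hU _ T0))).
  by rewrite le_max lexx orbT/= ge_max le_max lexx/= (le_trans _ q0)// oppr_le0.
have cu : continuous u.
  apply/(continuous_distP (V := R)) => a e e0.
  have T0 : 0 <= `|a| + 1 by rewrite addr_ge0.
  have [cU _ _] := hU _ T0.
  have [k k0 hk] := (continuous_distP (V := R) _).1 cU (Num.max a (- r)) _ e0.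
  exists (Num.min k 1); first by rewrite lt_min k0 ltr01.
  move=> q; rewrite lt_min => /andP[qk qa].
  have aT : a <= `|a| + 1 by rewrite (le_trans (ler_norm _))// lerDl.
  have qT : q <= `|a| + 1.
    move: qa; rewrite ltr_distl => /andP[_ /ltW /le_trans]; apply.
    by rewrite lerD2r ler_norm.
  by rewrite !(uE _ _ T0)//; apply: hk; exact: le_lt_trans (ler_dist_max _ _ _) qk.
exists u => T T0; apply: (sol_ext r_gt0 T0 cu _ (hU T T0)) => q /andP[q1 q2].
by rewrite (uE T)// max_l.
Qed.

(** * Comparison with mild solutions and well-posedness *)

Lemma sol_mild phi T u : sol phi T u -> mild_solution d E B eta phi T u.
Proof.
move=> su; have [cu u0 h] := su; split; first exact: continuous_subspaceT.
  by move=> s; rewrite in_itv => sr; exact: (sol_init su sr).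
move=> t; rewrite in_itv => tT; exists (u t - E t (phi 0)); last by rewrite subrKC.
exact: h.
Qed.

(** At times in [[0, T]] segments only read values on [[- r, T]], where clamping changes nothing, so
    the forcing terms agree. *)
Lemma mild_sol phi T u : 0 <= T -> mild_solution d E B eta phi T u ->
  sol phi T (fun t => u (clamp (- r) T t)).
Proof.
move=> T0 [cu u0 h]; have rT : - r <= T by rewrite (le_trans _ T0)// oppr_le0.
have c_id t : - r <= t <= T -> clamp (- r) T t = t by exact: clamp_id.
have cu' := within_clamp_continuous rT cu.
split=> // [|t /andP[t0 tT]].
  apply/history_at0 => // s sr; rewrite c_id; first by apply: u0; rewrite in_itv.
  by case/andP: sr => -> /le_trans; exact.
have [|I hI ut] := h t; first by rewrite in_itv/= t0.
rewrite c_id ?tT ?andbT ?(le_trans _ t0) ?oppr_le0// ut addrC addKr.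
apply: is_convolution_ext hI => s /andP[s0 st].
rewrite -[LHS]/(forcing u s); apply: eq_forcing => // q /andP[q1 q2]; rewrite c_id//.
by rewrite (le_trans q1) ?lerDr//= (le_trans _ (le_trans st tT))// gerDl.
Qed.

Lemma global_mild_unique phi u v : (forall T, 0 <= T -> sol phi T u) ->
  global_mild_solution d E B eta phi v -> forall t, - r <= t -> v t = u t.
Proof.
move=> su [_ mv] t rt; have T0 : 0 <= Num.max t 0 by rewrite le_max lexx orbT.
(* Global mild solutions are tested on horizons [T > 0], hence the [+ 1]. *)
have T1 : 0 < Num.max t 0 + 1 by rewrite ltr_wpDl.
have tT : - r <= t <= Num.max t 0 + 1 by rewrite rt (@le_trans _ _ (Num.max t 0))// ?lerDl// le_max lexx.
rewrite (sol_unique (ltW T1) (su _ (ltW T1)) (mild_sol (ltW T1) (mv _ T1)) tT).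
by rewrite clamp_id.
Qed.

(** The evolution operator takes segments of a chosen global solution. Uniqueness makes it agree
    with any other mild solution, and gives the composition law by comparing the solution restarted
    at [tau] with the one chosen for the segment at [tau]. *)
Theorem well_posed :
  (forall phi, exists u, global_mild_solution d E B eta phi u /\
    forall v, global_mild_solution d E B eta phi v -> forall t, - r <= t -> v t = u t) /\
  exists S : R -> history H r -> history H r,
    (forall phi u, global_mild_solution d E B eta phi u ->
      forall t, 0 <= t -> S t phi = seg u t) /\
    dynamical_system S.
Proof.
have /choice[U hU] := global_sol.
have cU phi : continuous (U phi) by case: (hU phi _ (lexx 0)).
split=> [phi|].
  exists (U phi); split; last by move=> v; exact: (global_mild_unique (hU phi)).
  by split=> [|T T0]; [exact: continuous_subspaceT|exact/sol_mild/hU/ltW].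
exists (fun t phi => seg (U phi) t); split=> [phi u mu t t0|].
  apply: eq_history_at => s /andP[s1 _]; apply/esym.
  by apply: (global_mild_unique (hU phi) mu); rewrite (le_trans s1)// lerDr.
split=> [phi|t tau t0 tau0 phi|phi|t t0 x_ x xx].
- by case: (hU phi _ (lexx 0)).
- apply: eq_history_at => s /andP[s1 s2].
  have T0 : 0 <= t + tau by exact: addr_ge0.
  have su : sol (seg (U phi) tau) t (fun q => U phi (q + tau)).
    rewrite -[t](addrK tau); apply: (sol_shift r_gt0 C0E LB_ge0 B_lip eta_bounds eta_cont _ (hU phi _ T0)).
    by rewrite tau0 lerDr.
  rewrite (sol_unique t0 (hU (seg (U phi) tau) t t0) su); first by rewrite addrAC.
  by rewrite gerDl s2 andbT (le_trans s1)// lerDr.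
- by apply: continuous_subspaceT; exact: history_at_continuous.
- apply/cvgrPdist_le => e e0; have [g g0 hg] := global_dependence t0 (hU x t t0) e0.
  have /cvgrPdist_le/(_ g g0) := xx; apply: filterS => n.
  rewrite !sub0r !normrN !normr_id => xg.
  apply: history_at_dist => // [|s /andP[s1 s2]]; first exact: ltW.
  rewrite distrC; apply: (hg _ _ (hU _ _ t0) xg).
  by rewrite gerDl s2 andbT (le_trans s1)// lerDr.
Qed.

End local_theory.

Theorem theorem2 (R : realType) (n0 : nat) (n0_gt0 : (0 < n0)%N)
    (Omega : smooth_bounded_domain R n0)
    (r : R) (r_gt0 : 0 < r) (d : R) (d_ge0 : 0 <= d)
    (DA : set (L2 Omega)) (A : L2 Omega -> L2 Omega)
    (A_linear : linear_operator DA A)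
    (A_densely_defined : dense DA)
    (A_self_adjoint : self_adjoint DA A)
    (A_positive : positive_operator DA A)
    (A_compact_resolvent : has_compact_resolvent DA A)
    (E : R -> L2 Omega -> L2 Omega)
    (E_semigroup : C0_semigroup E)
    (E_generator : generator E DA (fun v => - A v))
    (B : L2 Omega -> L2 Omega)
    (B_lipschitz : exists LB : R, forall v1 v2, `|B v1 - B v2| <= LB * `|v1 - v2|)
    (Theta_u Theta_l eta : history (L2 Omega) r -> R)
    (Theta_bounds : forall phi,
      0 <= Theta_l phi /\ Theta_l phi <= Theta_u phi /\ Theta_u phi <= r)
    (eta_bounds : forall phi, 0 <= eta phi /\ eta phi <= r)
    (Theta_u_continuous : continuous Theta_u)
    (Theta_l_continuous : continuous Theta_l)
    (Z_lipschitz : exists L : R,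
      forall phi, Theta_l phi = 0 -> lipschitz_history L phi)
    (eta_continuous : continuous eta)
    (eta_ignores : forall phi psi : history (L2 Omega) r,
      (forall theta, theta \in `[- Theta_u phi, - Theta_l phi] ->
        psi theta = phi theta) ->
      eta psi = eta phi)
    (eta_pos_on_Z : forall phi, Theta_l phi = 0 -> 0 < eta phi)
    (eta_lipschitz_near_Z : exists omega L_eta : R,
      [/\ 0 < omega, 0 < L_eta &
        forall phi psi : history (L2 Omega) r,
          (exists2 nu, Theta_l nu = 0 & `|phi - nu| <= omega) ->
          (exists2 nu, Theta_l nu = 0 & `|psi - nu| <= omega) ->
          `|eta phi - eta psi| <= L_eta * `|phi - psi|]) :
  (forall phi : history (L2 Omega) r, exists u : R -> L2 Omega,
    global_mild_solution d E B eta phi u /\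
    forall v : R -> L2 Omega, global_mild_solution d E B eta phi v ->
      forall t, - r <= t -> v t = u t) /\
  exists S : R -> history (L2 Omega) r -> history (L2 Omega) r,
    (forall (phi : history (L2 Omega) r) (u : R -> L2 Omega),
      global_mild_solution d E B eta phi u ->
      forall t, 0 <= t -> S t phi = history_at r u t) /\
    dynamical_system S.
Proof.
have [LB hLB] := B_lipschitz.
(* The given Lipschitz constant carries no sign, whereas the estimates use a nonnegative one. *)
have B_lip v1 v2 : `|B v1 - B v2| <= `|LB| * `|v1 - v2|.
  by apply: le_trans (hLB _ _) _; rewrite ler_wpM2r// ler_norm.
exact: (well_posed (H := L2 Omega) d r_gt0 E_semigroup (normr_ge0 LB) B_lip
  Theta_bounds eta_bounds Theta_l_continuous eta_continuous Z_lipschitz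
  eta_ignores eta_pos_on_Z eta_lipschitz_near_Z).
Qed.
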